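(* Let $p=p(n)\in(0,1]$. (i) If $n^{3/2}p=o(1)$, then whp exactly one of the following two statements holds: either $G_{n,p}$ has no edges, or $q^*(G_{n,p})=q_{\mathcal C}(G_{n,p})=1-1/e(G_{n,p})$. (ii) If $n^2p\to\infty$ and $np\le 1-(\log n)^{1/2}n^{-1/4}$, then whp $q^*(G_{n,p})=q_{\mathcal C}(G_{n,p})=1-\Theta\big(\frac{1}{n^2p(1-np)}\big)$, that is, there are constants $0<\alpha<\beta$ such that whp $q^*(G_{n,p})=q_{\mathcal C}(G_{n,p})$ and $\frac{\alpha}{n^2p(1-np)}\le 1-q_{\mathcal C}(G_{n,p})\le \frac{\beta}{n^2p(1-np)}$. (iii) If $0<\varepsilon\le 1/4$ and $1\le np\le 1+\varepsilon$, then whp $q^*(G_{n,p})\ge q_{\mathcal C}(G_{n,p})>1-(4\varepsilon)^2$.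
   Context: For a graph $G$ with $m\ge 1$ edges and a partition $\mathcal A$ of its vertex set, the modularity score is $q_{\mathcal A}(G)=\frac1m\sum_{A\in\mathcal A}e(A)-\frac{1}{4m^2}\sum_{A\in\mathcal A}\mathrm{vol}(A)^2$, where $e(A)$ is the number of edges within $A$ and $\mathrm{vol}(A)$ is the sum of the degrees of vertices in $A$. The modularity is $q^*(G)=\max_{\mathcal A}q_{\mathcal A}(G)$ over all vertex partitions. $\mathcal C$ denotes the connected components partition of $G$, whose parts are the vertex sets of the connected components of $G$. $e(G)$ is the number of edges of $G$. $G_{n,p}$ is the Erdős–Rényi random graph on $[n]$ with independent edge probability $p$; whp means with probability tending to $1$ as $n\to\infty$. *)

(* Defs.v *)
From HB Require Import structures.
From mathcomp Require Import all_boot all_order all_algebra.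
From mathcomp Require Import all_classical reals topology normedtype sequences.

Set Implicit Arguments.
Unset Strict Implicit.
Unset Printing Implicit Defensive.

Import Order.TTheory GRing.Theory Num.Theory.
Import numFieldNormedType.Exports.

Local Open Scope ring_scope.

Record simple_graph (V : finType) := SimpleGraph {
  edges : {set {set V}};
  edges_card2 : [forall e in edges, #|e| == 2] }.

HB.instance Definition _ (V : finType) := [isSub for @edges V].
HB.instance Definition _ (V : finType) := [Equality of simple_graph V by <:].
HB.instance Definition _ (V : finType) := [Choice of simple_graph V by <:].
HB.instance Definition _ (V : finType) := [Countable of simple_graph V by <:].
HB.instance Definition _ (V : finType) := [Finite of simple_graph V by <:].

Section Graph.
Variables (V : finType) (G : simple_graph V).
Implicit Types (v : V) (A : {set V}).

Definition adj : rel V := fun u v => [set u; v]%SET \in edges G.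

Definition nb_edges : nat := #|edges G|.

Definition edges_within A : nat := #|[set e in edges G | e \subset A]%SET|.

Definition degree v : nat := #|[set u | adj v u]%SET|.

Definition vol A : nat := (\sum_(v in A) degree v)%N.

Definition components : {set {set V}} :=
  equivalence_partition (connect adj) [set: V]%SET.

Lemma adj_sym : symmetric adj.
Proof. by move=> u v; rewrite /adj finset.setUC. Qed.

Lemma components_partition : finset.partition components [set: V]%SET.
Proof.
apply: equivalence_partitionP => x y z _ _ _; split; first exact: connect0.
by move=> cxy; rewrite (same_connect (sym_connect_sym adj_sym) cxy).
Qed.

End Graph.

Section Modularity.
Variables (R : realType) (V : finType) (G : simple_graph V).
Implicit Types P : {set {set V}}.

(* For an edgeless graph the score is 0, since 0^-1 = 0. *)
Definition mod_score P : R :=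
  (nb_edges G)%:R^-1 * (\sum_(A in P) (edges_within G A)%:R)
  - (4 * (nb_edges G)%:R ^+ 2)^-1 * (\sum_(A in P) (vol G A)%:R ^+ 2).

Definition singletons : {set {set V}} := [set [set v] | v in V]%SET.

(* The default value of the maximum is itself the score of a vertex
   partition, so it is the maximum over all partitions: see modularity_ub
   and modularity_attained. *)
Definition modularity : R :=
  \big[Num.max/mod_score singletons]_(P | finset.partition P [set: V]%SET)
    mod_score P.

Lemma modularity_ub P :
  finset.partition P [set: V]%SET -> mod_score P <= modularity.
Proof. by move=> hP; rewrite /modularity; apply: le_bigmax_cond. Qed.

Lemma singletons_partition : finset.partition singletons [set: V]%SET.
Proof.
apply/and3P; split.
- apply/eqP/setP => x; rewrite inE; apply/bigcupP.
  by exists [set x]%SET; rewrite ?inE//; apply: imset_f.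
- apply/finset.trivIsetP => _ _ /imsetP[x _ ->] /imsetP[y _ ->] nxy.
  by rewrite disjoints1 inE; apply: contraNN nxy => /eqP ->.
- by apply/imsetP => -[x _ /setP/(_ x)]; rewrite !inE eqxx.
Qed.

Lemma modularity_attained :
  exists2 P, finset.partition P [set: V]%SET & modularity = mod_score P.
Proof.
rewrite /modularity; apply: (@big_ind R
  (fun x => exists2 P, finset.partition P [set: V]%SET & x = mod_score P)) => [|x y [P hP ->] [Q hQ ->]|P hP].
- by exists singletons => //; exact: singletons_partition.
- by rewrite maxEle; case: ifP => _; [exists Q|exists P].
- by exists P.
Qed.

End Modularity.

Section Gnp.
Variable R : realType.

Definition gnp_weight (n : nat) (p : R) (G : simple_graph 'I_n) : R :=
  \prod_(e : {set 'I_n} | #|e| == 2) (if e \in edges G then p else 1 - p).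

Definition gnp_pr (n : nat) (p : R) (E : pred (simple_graph 'I_n)) : R :=
  \sum_(G | E G) gnp_weight p G.

Lemma gnp_pr_total (n : nat) (p : R) : gnp_pr p (@predT (simple_graph 'I_n)) = 1.
Proof.
pose Q (e : {set 'I_n}) := #|e| == 2.
transitivity (\prod_(e | Q e) \sum_(b : bool) (if b then p else 1 - p)); last first.
  by rewrite big1// => e _; rewrite big_bool/= addrC subrK.
rewrite (big_distr_big_dep false) /gnp_pr.
have G0P : [forall e in (finset.set0 : {set {set 'I_n}}), #|e| == 2].
  by apply/forall_inP => e; rewrite inE.
pose h (G : simple_graph 'I_n) : {ffun {set 'I_n} -> bool} := [ffun e => e \in edges G].
pose h' f : simple_graph 'I_n := insubd (SimpleGraph G0P) [set e | f e]%SET.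
rewrite [RHS](reindex_onto h h')/= => [|f /pfamilyP[/fintype.subsetP sf _]].
  apply: eq_big => [G|G _].
    symmetry; apply/andP; split.
      apply/pfamilyP; split => //; apply/fintype.subsetP => e.
      rewrite inE ffunE eqbF_neg negbK => eG; exact: (forall_inP (edges_card2 G)).
    apply/eqP/val_inj; rewrite val_insubd.
    have -> : [set e | h G e]%SET = edges G by apply/setP => e; rewrite inE ffunE.
    by rewrite edges_card2.
  by apply: eq_bigr => e _; rewrite ffunE.
apply/ffunP => e; rewrite ffunE.
have := val_insubd (SimpleGraph G0P) [set e | f e]%SET.
rewrite ifT => [->|]; first by rewrite inE.
apply/forall_inP => e'; rewrite inE => fe'; apply: sf; by rewrite inE fe'.
Qed.

Definition whp (p : nat -> R) (E : forall n, pred (simple_graph 'I_n)) : Prop :=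
  (gnp_pr (p n) (E n) @[n --> \oo] --> (1 : R))%classic.

End Gnp.

(* Main.v *)
(** A component with at most sqrt m edges is never worth splitting: splitting it
    cuts at least one edge, which costs 1/m, and gains at most vol^2/(4m^2).
    Hence q* = q_C as soon as all components are that small, and always
    1 - q_C = X/m^2, where X is the number of ordered pairs of edges lying in a
    common component.

    The law of the component of an edge is controlled by revealing one vertex
    pair at a time.  If r unrevealed pairs touch the explored set, then revealing
    one of them either lowers r by 1, or discovers an edge and raises r by at most
    n - 1.  So lam^s X^r, with s the number of edges found, is a supermartingale
    as soon as 1 - p + p lam X^n <= X.  Differences lam^s X^r - mu^s Y^r of two
    such expressions give in turn sharp moments of order delta^(1-2j) with
    delta = 1 - np, the tail of the largest component up to delta of order
    (log n)^(1/2) n^(-1/4), and, with lam = X = 1, the extinction probability in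
    the supercritical range.

    In (ii), X is concentrated by Chebyshev: pairs of edges in different
    components contribute at most (E X)^2 to E X^2, so that the variance is at
    most the expected sum of the fourth powers of the component sizes.  In (iii),
    the number of edges in components with at least K edges is a Lipschitz
    function of the edge indicators up to the total number of edges, and has mean
    at most (1 - (1 - rho)^2) E m with rho slightly above 2 eps. *)

Require Import Defs.
From mathcomp Require Import all_boot all_order all_algebra.
From mathcomp Require Import reals ring lra zify.

Set Implicit Arguments.
Unset Strict Implicit.
Unset Printing Implicit Defensive.

Import Order.TTheory GRing.Theory Num.Theory.

Local Open Scope ring_scope.

(** * Functions of a random subset *)

Section RandomSubset.
Variables (R : realFieldType) (T : finType) (p : R).
Implicit Types (D E : {set T}) (f g : {set T} -> R).

Definition bweight D E : R := \prod_(e in D) (if e \in E then p else 1 - p).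

(** Expectation over the random subset of [D] that keeps each element independently with probability
    [p]. The ground set is a parameter because the exploration removes revealed pairs from it. *)
Definition bexp D f : R := \sum_(E in powerset D) bweight D E * f E.

Lemma eq_bexp D f g : (forall E, E \subset D -> f E = g E) -> bexp D f = bexp D g.
Proof. by move=> fg; apply: eq_bigr => E; rewrite powersetE => /fg ->. Qed.

Lemma bexpD D f g : bexp D (fun E => f E + g E) = bexp D f + bexp D g.
Proof. by rewrite -big_split; apply: eq_bigr => E _; rewrite mulrDr. Qed.

Lemma bexpZ D a f : bexp D (fun E => a * f E) = a * bexp D f.
Proof. by rewrite /bexp mulr_sumr; apply: eq_bigr => E _; rewrite mulrCA. Qed.

Lemma bexp_sum (I : finType) (P : pred I) D (F : I -> {set T} -> R) :
  bexp D (fun E => \sum_(i | P i) F i E) = \sum_(i | P i) bexp D (F i).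
Proof.
rewrite /bexp exchange_big /=; apply: eq_bigr => E _; by rewrite mulr_sumr.
Qed.

Lemma bexp_set0 f : bexp set0 f = f set0.
Proof. by rewrite /bexp powerset0 big_set1 /bweight big_set0 mul1r. Qed.

(** Conditioning on the presence of [e]; the later inductions on the ground set rest on this
    recursion. *)
Lemma bexpD1 e D f : e \in D ->
  bexp D f = p * bexp (D :\ e) (fun E => f (e |: E)) + (1 - p) * bexp (D :\ e) f.
Proof.
move=> eD; rewrite /bexp (bigID (fun E : {set T} => e \in E)) /=; congr (_ + _).
- rewrite (reindex_onto (fun E => e |: E) (fun E => E :\ e)) /=; last first.
    by move=> E /andP[_ eE]; rewrite setD1K.
  rewrite mulr_sumr; apply: eq_big => [E|E].
    rewrite !powersetE setU11 andbT subUset sub1set eD /=; apply/andP/idP.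
      move=> [ED /eqP EE]; rewrite -EE; apply: setSD; by rewrite subUset sub1set eD.
    by move=> /subsetD1P[ED eE]; split=> //; rewrite setU1K.
  rewrite powersetE => /andP[/andP[_ _] /eqP EE]; rewrite mulrA; congr (_ * _).
  rewrite /bweight (bigD1 e) //= setU11; congr (_ * _).
  apply: eq_big => [x|x /andP[xD xe]]; first by rewrite !inE andbC.
  by rewrite !inE (negbTE xe).
- rewrite mulr_sumr; apply: eq_big => [E|E].
    by rewrite !powersetE subsetD1.
  move=> /andP[_ eE]; rewrite mulrA; congr (_ * _).
  rewrite /bweight (bigD1 e) //= (negbTE eE); congr (_ * _).
  by apply: eq_bigl => x; rewrite !inE andbC.
Qed.

Lemma bset_ind (P : {set T} -> Prop) :
  (forall D, (forall e, e \in D -> P (D :\ e)) -> P D) -> forall D, P D.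
Proof.
move=> IH D; have [k] := ubnP #|D|; elim: k D => // k IHk D Dk.
apply: IH => e eD; apply: IHk.
by move: Dk; rewrite (cardsD1 e D) eD.
Qed.

Lemma bexp_cst D a : bexp D (fun _ => a) = a.
Proof.
elim/bset_ind: D => D IH.
have [->|[e eD]] := set_0Vmem D; first by rewrite bexp_set0.
by rewrite (bexpD1 _ eD) IH //; ring.
Qed.

Lemma bexp_mem D e f : e \in D ->
  bexp D (fun E => (e \in E)%:R * f E) = p * bexp (D :\ e) (fun E => f (e |: E)).
Proof.
move=> eD; rewrite (bexpD1 _ eD) -[RHS]addr0; congr (_ * _ + _).
  by apply: eq_bexp => E _; rewrite setU11 mul1r.
rewrite -[RHS](mulr0 (1 - p)); congr (_ * _).
rewrite -[RHS](bexp_cst (D :\ e)); apply: eq_bexp => E /subsetD1P[_ eE].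
by rewrite (negbTE eE) mul0r.
Qed.

Hypothesis p01 : 0 <= p <= 1.

Lemma bweight_ge0 D E : 0 <= bweight D E.
Proof. by apply: prodr_ge0 => e _; case: ifP => _; move: p01 => /andP[]; lra. Qed.

Lemma bexp_le D f g : (forall E, E \subset D -> f E <= g E) -> bexp D f <= bexp D g.
Proof.
move=> fg; apply: ler_sum => E; rewrite powersetE => ED.
by apply: ler_wpM2l; rewrite ?bweight_ge0 ?fg.
Qed.

Lemma bexp_ge0 D f : (forall E, E \subset D -> 0 <= f E) -> 0 <= bexp D f.
Proof. by move=> f0; rewrite -(bexp_cst D 0); exact: bexp_le. Qed.

Lemma bexp_subset D D' f : D \subset D' ->
  (forall E E', E \subset E' -> f E <= f E') -> bexp D f <= bexp D' f.
Proof.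
move=> + fm; elim/bset_ind: D' => D' IH DD'.
have [/eqP <-//|] := boolP (D == D').
rewrite eqEsubset DD' /= => /subsetPn[e eD' eD].
apply: le_trans (IH e eD' _) _; first by apply/subsetD1P.
rewrite (bexpD1 f eD').
have : bexp (D' :\ e) f <= bexp (D' :\ e) (fun E => f (e |: E)).
  by apply: bexp_le => E _; apply: fm; exact: subsetUr.
move: p01 => /andP[p0 p1] h; nra.
Qed.

Lemma bexp_markov D (Q : pred {set T}) f (t : R) : 0 < t ->
  (forall E, E \subset D -> 0 <= f E) ->
  (forall E, E \subset D -> Q E -> t <= f E) ->
  bexp D (fun E => (Q E)%:R) <= bexp D f / t.
Proof.
move=> t0 f0 Qf; rewrite ler_pdivlMr// mulrC -bexpZ; apply: bexp_le => E ED.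
by case: (boolP (Q E)) => QE; rewrite ?mulr1 ?mulr0 ?f0 ?Qf.
Qed.

Lemma bexp_union D (Q Q' : pred {set T}) :
  bexp D (fun E => (Q E || Q' E)%:R) <=
  bexp D (fun E => (Q E)%:R) + bexp D (fun E => (Q' E)%:R).
Proof.
by rewrite -bexpD; apply: bexp_le => E _; case: (Q E); case: (Q' E); rewrite /=; lra.
Qed.

Definition bvar D f := bexp D (fun E => f E ^+ 2) - bexp D f ^+ 2.

Lemma bvarE D f : bvar D f = bexp D (fun E => (f E - bexp D f) ^+ 2).
Proof.
rewrite /bvar; set a := bexp D f.
transitivity (bexp D (fun E => f E ^+ 2 + (- (2 * a) * f E + a ^+ 2))).
  by rewrite !bexpD bexpZ bexp_cst -/a; ring.
by apply: eq_bexp => E _; ring.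
Qed.

Lemma bexp_chebyshev D f (t : R) : 0 < t ->
  bexp D (fun E => (t <= `|f E - bexp D f|)%R%:R) <= bvar D f / t ^+ 2.
Proof.
move=> t0; rewrite bvarE; apply: bexp_markov => [|E _|E _ tE].
- by rewrite exprn_gt0.
- exact: sqr_ge0.
- by rewrite -[leRHS]real_normK ?num_real// ler_sqr ?nnegrE ?normr_ge0 ?(ltW t0).
Qed.

(** Revealing one element splits the variance into the mean of the two conditional variances and
    [p * (1 - p)] times the squared gap of the conditional means. That gap is at most [L]. *)
Lemma bvar_lipschitz D f (L : R) :
  (forall e E, e \in D -> E \subset D -> e \notin E -> `|f (e |: E) - f E| <= L) ->
  bvar D f <= #|D|%:R * p * L ^+ 2.
Proof.
elim/bset_ind: D f => D IH f lip.
have [D0|[e eD]] := set_0Vmem D.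
  by rewrite D0 /bvar !bexp_set0 cards0 subrr !mul0r.
have sub E : E \subset D :\ e -> E \subset D by move=> /subsetD1P[].
have IH0 : bvar (D :\ e) f <= #|D :\ e|%:R * p * L ^+ 2.
  apply: IH => // e' E /setD1P[_ e'D] ED; apply: lip => //; exact: sub.
have IH1 : bvar (D :\ e) (fun E => f (e |: E)) <= #|D :\ e|%:R * p * L ^+ 2.
  apply: IH => // e' E /setD1P[e'e e'D] ED e'E.
  rewrite setUCA; apply: lip => //.
    by rewrite subUset sub1set eD sub.
  by rewrite !inE negb_or e'e.
have L0 : `|bexp (D :\ e) (fun E => f (e |: E)) - bexp (D :\ e) f| <= L.
  rewrite ler_norml; apply/andP; split.
    rewrite lerBrDl -(bexp_cst (D :\ e) (- L)) -bexpD; apply: bexp_le => E ED.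
    have := lip e E eD (sub _ ED); move: (ED) => /subsetD1P[_ eE] /(_ eE).
    by rewrite ler_norml => /andP[]; lra.
  rewrite lerBlDl -(bexp_cst (D :\ e) L) -bexpD; apply: bexp_le => E ED.
  have := lip e E eD (sub _ ED); move: (ED) => /subsetD1P[_ eE] /(_ eE).
  by rewrite ler_norml => /andP[]; lra.
have L2 : (bexp (D :\ e) (fun E => f (e |: E)) - bexp (D :\ e) f) ^+ 2 <= L ^+ 2.
  rewrite -[leLHS]real_normK ?num_real// ler_sqr ?nnegrE ?normr_ge0//.
  exact: le_trans L0.
rewrite (cardsD1 e D) eD natrD.
move: IH0 IH1 L2; rewrite /bvar !(bexpD1 _ eD).
set a2 := bexp _ (fun E => f (e |: E) ^+ 2); set a := bexp _ (fun E => f (e |: E)).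
set b2 := bexp _ (fun E => f E ^+ 2); set b := bexp _ f.
set k := (#|D :\ e|%:R * p * L ^+ 2) => IH0 IH1 L2.
have -> : (1%:R + #|D :\ e|%:R) * p * L ^+ 2 = k + p * L ^+ 2 by rewrite /k; ring.
have -> : p * a2 + (1 - p) * b2 - (p * a + (1 - p) * b) ^+ 2 =
   p * (a2 - a ^+ 2) + (1 - p) * (b2 - b ^+ 2) + p * (1 - p) * (a - b) ^+ 2 by ring.
move: p01 => /andP[p0 p1].
have h1 : p * (a2 - a ^+ 2) <= p * k by rewrite ler_wpM2l.
have h2 : (1 - p) * (b2 - b ^+ 2) <= (1 - p) * k by rewrite ler_wpM2l// subr_ge0.
have h3 : p * (1 - p) * (a - b) ^+ 2 <= p * (a - b) ^+ 2.
  rewrite ler_wpM2r ?sqr_ge0// ler_piMr//; lra.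
have h4 : p * (a - b) ^+ 2 <= p * L ^+ 2 by rewrite ler_wpM2l.
lra.
Qed.

End RandomSubset.

(** * Components of an edge set *)

Section Reach.
Variable V : finType.
Implicit Types (u v w : V) (A B f : {set V}) (D E : {set {set V}}).

Definition eadj E : rel V := fun u v => [set u; v] \in E.

Definition pairs : {set {set V}} := [set e : {set V} | #|e| == 2].

Definition hull A E : {set V} := [set v | [exists u in A, connect (eadj E) u v]].

(** The hull is closed under adjacency, so these are the edges of the components meeting [A];
    component sizes are counted this way, in edges. *)
Definition reach A E : {set {set V}} := [set f in E | ~~ [disjoint f & hull A E]].

Lemma eadj_sym E : symmetric (eadj E).
Proof. by move=> u v; rewrite /eadj setUC. Qed.

Lemma econnect_sym E u v : connect (eadj E) u v = connect (eadj E) v u.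
Proof. exact/sym_connect_sym/eadj_sym. Qed.

Lemma sub_hull A E : A \subset hull A E.
Proof. by apply/subsetP => u uA; rewrite inE; apply/existsP; exists u; rewrite uA connect0. Qed.

Lemma hull_closed A E u v : [set u; v] \in E -> u \in hull A E -> v \in hull A E.
Proof.
move=> uv; rewrite !inE => /existsP[w /andP[wA wu]]; apply/existsP; exists w.
by rewrite wA (connect_trans wu)// connect1.
Qed.

Lemma hull_min A E B : A \subset B ->
  (forall u v, [set u; v] \in E -> u \in B -> v \in B) -> hull A E \subset B.
Proof.
move=> /subsetP AB clB; apply/subsetP => v; rewrite inE => /existsP[u /andP[/AB uB]].
move=> /connectP[s + ->] {v}; elim: s u uB => //= w s IH u uB /andP[uw ws].
by apply: IH ws; apply: clB uB.
Qed.

Lemma mem_hull1 E u v : (v \in hull [set u] E) = connect (eadj E) u v.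
Proof.
rewrite inE; apply/existsP/idP => [[w /andP[/set1P->]]//|uv].
by exists u; rewrite set11.
Qed.

Lemma hull1_eq E u v : v \in hull [set u] E -> hull [set v] E = hull [set u] E.
Proof.
rewrite mem_hull1 => uv; apply/setP => w; rewrite !mem_hull1.
by apply/idP/idP; apply: connect_trans => //; rewrite econnect_sym.
Qed.

Lemma hull_pair E u v : [set u; v] \in E -> hull [set u; v] E = hull [set u] E.
Proof.
move=> uv; apply/eqP; rewrite eqEsubset; apply/andP; split; apply: hull_min => [|x y].
- rewrite subUset !sub1set mem_hull1 connect0 /=; apply: hull_closed uv _.
  by rewrite mem_hull1 connect0.
- exact: hull_closed.
- by apply: subset_trans (sub_hull _ _); exact: subsetUl.
- exact: hull_closed.
Qed.

Lemma pairsP f : reflect (exists u v, u != v /\ f = [set u; v]) (f \in pairs).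
Proof. by rewrite inE; exact: cards2P. Qed.

Lemma pair_at f u : f \in pairs -> u \in f -> exists2 v, v != u & f = [set u; v].
Proof.
move=> /pairsP[a [b [ab ->]]]; rewrite !inE => /orP[]/eqP ->.
  by exists b; rewrite // eq_sym.
by exists a => //; rewrite setUC.
Qed.

Lemma hull_edge E f u : E \subset pairs -> f \in E -> u \in f ->
  hull f E = hull [set u] E.
Proof.
move=> /subsetP EP fE uf; have [v _ fuv] := pair_at (EP _ fE) uf.
by rewrite fuv hull_pair -?fuv.
Qed.

(** Discovering an edge from the explored set amounts to adding its other endpoint to that set; the
    edge itself can then be forgotten. *)
Lemma hullU1 A E u v : u \in A -> hull A ([set u; v] |: E) = hull (v |: A) E.
Proof.
move=> uA; apply/eqP; rewrite eqEsubset; apply/andP; split; apply: hull_min.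
- exact: subset_trans (subsetUr _ _) (sub_hull _ _).
- move=> x y; rewrite in_setU1 => /predU1P[xy|]; last exact: hull_closed.
  have : y \in [set u; v] by rewrite -xy !inE eqxx orbT.
  move=> + _; rewrite !inE; case/orP => /eqP ->; apply/existsP.
    by exists u; rewrite !inE uA orbT connect0.
  by exists v; rewrite !inE eqxx connect0.
- rewrite subUset sub_hull andbT sub1set; apply: (@hull_closed _ _ u).
    by rewrite !inE eqxx.
  exact: (subsetP (sub_hull _ _)).
- by move=> x y xy; apply: hull_closed; rewrite in_setU1 xy orbT.
Qed.

Lemma reachU1 A E u v : u \in A ->
  reach A ([set u; v] |: E) = [set u; v] |: reach (v |: A) E.
Proof.
move=> uA; apply/setP => f; rewrite !inE hullU1//.
case: eqVneq => //= ->; apply/pred0Pn; exists u; rewrite /= !inE eqxx /=.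
by apply/existsP; exists u; rewrite !inE uA orbT connect0.
Qed.

Lemma card_reachU1 A E u v : u \in A -> [set u; v] \notin E ->
  #|reach A ([set u; v] |: E)| = #|reach (v |: A) E|.+1.
Proof. by move=> uA uvE; rewrite reachU1// cardsU1 inE (negbTE uvE). Qed.

Lemma hull_disjoint A E : (forall f, f \in E -> [disjoint f & A]) -> hull A E = A.
Proof.
move=> dj; apply/eqP; rewrite eqEsubset sub_hull andbT; apply: hull_min => // u v.
by move=> /dj; rewrite disjoint_subset => /subsetP/(_ u); rewrite !inE eqxx => /(_ isT)/negbTE->.
Qed.

Lemma reach_disjoint A E : (forall f, f \in E -> [disjoint f & A]) -> reach A E = set0.
Proof.
move=> dj; apply/setP => f; rewrite !inE hull_disjoint//.
by case: (boolP (f \in E)) => //= /dj ->.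
Qed.

(** Each discovered edge brings in at most one new vertex. *)
Lemma card_hull A E : E \subset pairs -> (#|hull A E| <= #|A| + #|reach A E|)%N.
Proof.
elim/bset_ind: E A => E IH A EP.
have [/forall_inP dj|/forall_inPn[f fE fA]] := boolP [forall f in E, [disjoint f & A]].
  by rewrite hull_disjoint ?leq_addr.
have /pred0Pn[u /andP[/= uf uA]] := fA.
have [v _ fuv] := pair_at (subsetP EP _ fE) uf.
have fE' : f \notin E :\ f by rewrite !inE eqxx.
have EE : E = [set u; v] |: E :\ f by rewrite -fuv setD1K.
rewrite {1 2}EE hullU1// card_reachU1 -?fuv//.
apply: leq_trans (IH f fE (v |: A) _) _; first exact: subset_trans (subsetDl _ _) EP.
by rewrite cardsU1 addnS -addSn leq_add2r; case: (v \in A).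
Qed.

Lemma reach_mono A E E' : E \subset E' -> reach A E \subset reach A E'.
Proof.
move=> EE'; have HH : hull A E \subset hull A E'.
  apply: hull_min; first exact: sub_hull.
  by move=> x y /(subsetP EE'); exact: hull_closed.
apply/subsetP => g; rewrite !inE => /andP[/(subsetP EE') -> /=]; apply: contra.
exact: disjointWr.
Qed.

(** With [D] the unrevealed pairs and [A] the explored vertices, these are the pairs the exploration
    can still query. *)
Definition touching A D : {set {set V}} := [set e in D | ~~ [disjoint e & A]].

Lemma touching0 A D E f : touching A D = set0 -> E \subset D -> f \in E -> [disjoint f & A].
Proof.
move=> /setP/(_ f) + /subsetP ED /ED fD; rewrite !inE fD /=.
by case: [disjoint f & A].
Qed.

Lemma card_touching1 D v : D \subset pairs -> (#|touching [set v] D| <= #|V|)%N.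
Proof.
move=> DP; rewrite -(cardsT V).
apply: (@leq_trans #|[set [set v; w] | w in setT]|); last exact: leq_imset_card.
apply/subset_leq_card/subsetP => f; rewrite inE => /andP[/(subsetP DP) fP].
rewrite disjoint_sym disjoints1 negbK => vf; have [w _ ->] := pair_at fP vf.
by apply/imsetP; exists w.
Qed.

Lemma touchingU A B D : touching (A :|: B) D = touching A D :|: touching B D.
Proof.
apply/setP => f; rewrite !inE -andb_orr; congr (_ && _).
by rewrite -!setI_eq0 setIUr setU_eq0 negb_and.
Qed.

End Reach.

(** * Exploring a component edge by edge *)

Section Exploration.
Variables (R : realFieldType) (V : finType) (p : R).
Hypothesis p01 : 0 <= p <= 1.
Implicit Types (u v w : V) (A B f : {set V}) (D E : {set {set V}}).

Lemma touching_step A D u v : D \subset pairs V -> u \in A -> [set u; v] \in D ->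
  (#|touching (v |: A) (D :\ [set u; v])| < #|touching A D| + #|V|)%N.
Proof.
move=> DP uA eD; rewrite touchingU.
have -> : #|touching A D| = #|touching A (D :\ [set u; v])|.+1.
  rewrite [LHS](cardsD1 [set u; v]) !inE eD /= -setI_eq0.
  have -> /= : [set u; v] :&: A != set0 by apply/set0Pn; exists u; rewrite !inE eqxx.
  congr (_.+1); apply: eq_card => f; rewrite !inE andbA; congr (_ && _).
rewrite addSn ltnS addnC; apply: leq_trans (leq_card_setU _ _) _.
by rewrite leq_add2r; apply: card_touching1; exact: subset_trans (subsetDl _ _) DP.
Qed.

(** [Psi s r] is attached to a state with [s] edges found and [r] pairs to query; the third
    hypothesis makes it a supermartingale. Monotonicity in [r] enters because the new number of
    pairs is only bounded from above. *)
Lemma exploration_bound (F : nat -> R) (Psi : nat -> nat -> R) A D s :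
  (forall s, F s <= Psi s 0%N) ->
  (forall s r r', (r <= r')%N -> Psi s r <= Psi s r') ->
  (forall s r, (1 - p) * Psi s r + p * Psi s.+1 (r + #|V|)%N <= Psi s r.+1) ->
  D \subset pairs V ->
  bexp p D (fun E => F (s + #|reach A E|)%N) <= Psi s #|touching A D|.
Proof.
move=> FPsi Psim Psis; elim/bset_ind: D A s => D IH A s DP.
(* With no pair left to query the exploration is over and nothing more is reached. *)
have [D0|[f]] := set_0Vmem (touching A D).
  rewrite D0 cards0; apply: le_trans (FPsi s).
  rewrite -[leRHS](bexp_cst p D); apply: bexp_le => // E ED.
  rewrite reach_disjoint ?cards0 ?addn0// => f; exact: touching0 D0 ED.
rewrite inE => /andP[fD fA].
have /pred0Pn[u /andP[/= uf uA]] := fA.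
have [v _ fuv] := pair_at (subsetP DP _ fD) uf; subst f.
have DP' : D :\ [set u; v] \subset pairs V by exact: subset_trans (subsetDl _ _) DP.
rewrite (bexpD1 _ _ fD).
have step := touching_step DP uA fD.
have : (#|touching A (D :\ [set u; v])| < #|touching A D|)%N.
  apply: proper_card; apply/properP; split.
    apply/subsetP => f; rewrite !inE => /andP[/andP[_ ->] ->] //.
  by exists [set u; v]; rewrite !inE ?fD ?fA// eqxx.
case: #|touching A D| step => // r step; rewrite ltnS => tr.
apply: le_trans (Psis s r); rewrite addrC; have /andP[p0 p1] := p01.
apply: lerD; apply: ler_wpM2l; rewrite ?subr_ge0//.
  by apply: le_trans (IH _ fD A s DP') _; exact: Psim.
apply: le_trans (_ : bexp p (D :\ [set u; v])
    (fun E => F (s.+1 + #|reach (v |: A) E|)%N) <= _).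
  apply: bexp_le => // E /subsetD1P[_ eE].
  by rewrite card_reachU1// addnS addSn.
by apply: le_trans (IH _ fD _ _ DP') _; apply: Psim; rewrite -ltnS.
Qed.

(** This is X: ordered pairs of edges in a common component, each edge being paired with itself as
    well. *)
Definition nb_linked E : R := \sum_(f in E) #|reach f E|%:R.

Definition nb_linked_off A E : R := \sum_(f in E :\: reach A E) #|reach f E|%:R.

Lemma reachU_off E u v f : u \notin hull f E -> v \notin hull f E ->
  [set u; v] \notin E -> reach f ([set u; v] |: E) = reach f E.
Proof.
move=> uf vf eE.
have hE : hull f ([set u; v] |: E) = hull f E.
  apply/eqP; rewrite eqEsubset; apply/andP; split; apply: hull_min; rewrite ?sub_hull//.
    move=> x y; rewrite in_setU1 => /predU1P[xy|]; last exact: hull_closed.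
    have : x \in [set u; v] by rewrite -xy !inE eqxx.
    by rewrite in_set2 => /orP[]/eqP ->; rewrite ?(negbTE uf) ?(negbTE vf).
  by move=> x y xy; apply: hull_closed; rewrite in_setU1 xy orbT.
apply/setP => g; rewrite !inE hE; case: eqVneq => //= ->; rewrite (negbTE eE) /=.
apply: negbF; apply/pred0P => w /=; rewrite in_set2.
by apply/negbTE/negP => /andP[/orP[]/eqP ->]; rewrite ?(negbTE uf) ?(negbTE vf).
Qed.

Lemma notin_hull_off A E w f : E \subset pairs V -> f \in E ->
  f \notin reach A E -> w \in A -> w \notin hull f E.
Proof.
move=> EP fE fR wA; have [a [b [ab fab]]] := pairsP _ (subsetP EP _ fE).
have af : a \in f by rewrite fab !inE eqxx.
apply: contra fR => wf; rewrite inE fE /=; apply/pred0Pn; exists a.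
rewrite /= af inE /=; apply/existsP; exists w; rewrite wA /=.
by move: wf; rewrite (hull_edge EP fE af) mem_hull1 econnect_sym.
Qed.

Lemma nb_linked_offU1 A E u v : E \subset pairs V -> u \in A -> [set u; v] \notin E ->
  nb_linked_off A ([set u; v] |: E) = nb_linked_off (v |: A) E.
Proof.
move=> EP uA eE; rewrite /nb_linked_off reachU1//.
have -> : ([set u; v] |: E) :\: ([set u; v] |: reach (v |: A) E) = E :\: reach (v |: A) E.
  apply/setP => f; rewrite in_setD in_setD in_setU1 in_setU1 negb_or.
  by case: eqVneq => //= ->; rewrite (negbTE eE) andbF.
apply: eq_bigr => f; rewrite in_setD => /andP[fR fE].
by rewrite reachU_off//; apply: notin_hull_off fR _ => //; rewrite in_setU1 ?eqxx// uA orbT.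
Qed.

(* Exploring the component of A leaves the edges outside of it unrevealed; this
   is the only form of the van den Berg--Kesten inequality that is needed. *)
Lemma exploration_independence (G : nat -> R) (M : R) A D s :
  (forall k, 0 <= G k) -> D \subset pairs V ->
  (forall D', D' \subset D -> bexp p D' nb_linked <= M) ->
  bexp p D (fun E => G (s + #|reach A E|)%N * nb_linked_off A E) <=
  bexp p D (fun E => G (s + #|reach A E|)%N) * M.
Proof.
move=> G0; elim/bset_ind: D A s => D IH A s DP DM.
(* Once the exploration is complete the explored size is determined, and the edges off it form a
   fresh random subset of [D]. *)
have [D0|[f]] := set_0Vmem (touching A D).
  have R0 E : E \subset D -> reach A E = set0.
    by move=> ED; apply: reach_disjoint => f; exact: touching0 D0 ED.
  rewrite (eq_bexp p (g := fun E => G s * nb_linked E)); last first.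
    by move=> E ED; rewrite /nb_linked_off R0// cards0 addn0 setD0.
  rewrite (eq_bexp p (f := fun E => G (s + _)%N) (g := fun _ => G s)); last first.
    by move=> E ED; rewrite R0// cards0 addn0.
  by rewrite bexpZ bexp_cst ler_wpM2l// DM.
rewrite inE => /andP[fD fA].
have /pred0Pn[u /andP[/= uf uA]] := fA.
have [v _ fuv] := pair_at (subsetP DP _ fD) uf; subst f.
have DP' : D :\ [set u; v] \subset pairs V by exact: subset_trans (subsetDl _ _) DP.
have DM' D' : D' \subset D :\ [set u; v] -> bexp p D' nb_linked <= M.
  by move=> /subset_trans D'D; apply/DM/D'D/subsetDl.
rewrite !(bexpD1 _ _ fD) [leRHS]mulrDl -!mulrA; have /andP[p0 p1] := p01.
apply: lerD; apply: ler_wpM2l; rewrite ?subr_ge0 ?IH//.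
have e1 : bexp p (D :\ [set u; v]) (fun E =>
    G (s + #|reach A ([set u; v] |: E)|)%N * nb_linked_off A ([set u; v] |: E)) =
    bexp p (D :\ [set u; v]) (fun E =>
    G (s.+1 + #|reach (v |: A) E|)%N * nb_linked_off (v |: A) E).
  apply: eq_bexp => E /subsetD1P[ED eE].
  by rewrite nb_linked_offU1 ?(subset_trans ED)// card_reachU1// addnS addSn.
have e2 : bexp p (D :\ [set u; v]) (fun E => G (s + #|reach A ([set u; v] |: E)|)%N) =
    bexp p (D :\ [set u; v]) (fun E => G (s.+1 + #|reach (v |: A) E|)%N).
  apply: eq_bexp => E /subsetD1P[ED eE].
  by rewrite card_reachU1// addnS addSn.
by rewrite e1 e2; exact: IH.
Qed.

(** Lets the exploration start from the two endpoints of an edge, with that edge already found. *)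
Lemma reach_root f E : f \in E -> E \subset pairs V ->
  reach f E = f |: reach f (E :\ f).
Proof.
move=> fE EP; have [a [b [ab fab]]] := pairsP _ (subsetP EP _ fE).
have -> : reach f E = reach f ([set a; b] |: E :\ f) by rewrite -fab setD1K.
rewrite reachU1 ?fab ?inE ?eqxx// setUA.
congr (_ |: reach _ _); apply/setP => x.
by rewrite !inE; case: (x == b); rewrite ?orbT.
Qed.

Lemma card_reach_root f E : f \in E -> E \subset pairs V ->
  #|reach f E| = #|reach f (E :\ f)|.+1.
Proof. by move=> fE EP; rewrite reach_root// cardsU1 !inE eqxx. Qed.

Lemma bexp_sum_edges (h : {set V} -> {set {set V}} -> R) :
  bexp p (pairs V) (fun E => \sum_(f in E) h f E) =
  \sum_(f in pairs V) p * bexp p (pairs V :\ f) (fun E => h f (f |: E)).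
Proof.
transitivity (bexp p (pairs V)
    (fun E => \sum_(f in pairs V) (f \in E)%:R * h f E)).
  apply: eq_bexp => E EP; rewrite [RHS]big_mkcond [LHS]big_mkcond /=.
  apply: eq_bigr => f _; case: (boolP (f \in E)) => fE; last by rewrite mul0r if_same.
  by rewrite (subsetP EP)// mul1r.
by rewrite bexp_sum; apply: eq_bigr => f fP; rewrite bexp_mem.
Qed.

Lemma bexp_sum_reach (F : nat -> R) :
  bexp p (pairs V) (fun E => \sum_(f in E) F #|reach f E|) =
  \sum_(f in pairs V) p * bexp p (pairs V :\ f) (fun E => F #|reach f E|.+1).
Proof.
rewrite bexp_sum_edges; apply: eq_bigr => f fP; congr (_ * _).
apply: eq_bexp => E /subsetD1P[EP fE]; rewrite card_reach_root ?setU11// ?setU1K//.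
by rewrite subUset sub1set fP.
Qed.

(** The root is a present pair, so the exploration starts with one edge found and at most [2 * #|V|]
    pairs touching its endpoints. *)
Lemma rooted_bound (F : nat -> R) (Psi : nat -> nat -> R) :
  (forall s, F s <= Psi s 0%N) ->
  (forall s r r', (r <= r')%N -> Psi s r <= Psi s r') ->
  (forall s r, (1 - p) * Psi s r + p * Psi s.+1 (r + #|V|)%N <= Psi s r.+1) ->
  bexp p (pairs V) (fun E => \sum_(f in E) F #|reach f E|) <=
  #|pairs V|%:R * p * Psi 1%N (2 * #|V|)%N.
Proof.
move=> FPsi Psim Psis; rewrite bexp_sum_reach -mulrA mulr_natl -sumr_const.
have /andP[p0 _] := p01.
apply: ler_sum => f fP; apply: ler_wpM2l => //.
have DP : pairs V :\ f \subset pairs V by exact: subsetDl.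
apply: le_trans (exploration_bound f 1 FPsi Psim Psis DP) _; apply: Psim.
have [a [b [_ ->]]] := pairsP _ fP.
rewrite touchingU mul2n -addnn; apply: leq_trans (leq_card_setU _ _) _.
by apply: leq_add; apply: card_touching1; exact: subsetDl.
Qed.

Lemma nb_linked_mono E E' : E \subset E' -> nb_linked E <= nb_linked E'.
Proof.
move=> EE'; rewrite /nb_linked [leRHS](big_setID E) /= (setIidPr EE') ler_wpDr ?sumr_ge0//.
by apply: ler_sum => f _; rewrite ler_nat; apply/subset_leq_card/reach_mono.
Qed.

Lemma reach_eq f g E : E \subset pairs V -> f \in E -> g \in reach f E -> reach g E = reach f E.
Proof.
move=> EP fE; rewrite inE => /andP[gE /pred0Pn[u /andP[/= ug uf]]].
suff hE : hull g E = hull f E by apply/setP => x; rewrite !inE hE.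
have [a [b [_ fab]]] := pairsP _ (subsetP EP _ fE).
have af : a \in f by rewrite fab !inE eqxx.
rewrite (hull_edge EP gE ug) (hull_edge EP fE af); apply: hull1_eq.
by rewrite -(hull_edge EP fE af).
Qed.

Lemma nb_linked_split f E : E \subset pairs V -> f \in E ->
  nb_linked E = #|reach f E|%:R ^+ 2 + nb_linked_off f E.
Proof.
move=> EP fE; rewrite /nb_linked (big_setID (reach f E)) /=; congr (_ + _).
rewrite (setIidPr _); last by apply/subsetP => g; rewrite inE => /andP[].
rewrite (eq_bigr (fun _ => #|reach f E|%:R)); last by move=> g /(reach_eq EP fE) ->.
by rewrite sumr_const expr2 mulr_natr.
Qed.

(** In the second moment, a component with k edges contributes k^4 by itself, that is k^3 for each
    of its edges. The cross terms add up to at most the squared mean by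
    [exploration_independence]. *)
Lemma bvar_nb_linked :
  bvar p (pairs V) nb_linked <=
  bexp p (pairs V) (fun E => \sum_(f in E) #|reach f E|%:R ^+ 3).
Proof.
rewrite /bvar lerBlDr.
set M := bexp p (pairs V) nb_linked.
have -> : bexp p (pairs V) (fun E => nb_linked E ^+ 2) =
   bexp p (pairs V) (fun E => \sum_(f in E) #|reach f E|%:R ^+ 3) +
   bexp p (pairs V) (fun E => \sum_(f in E) #|reach f E|%:R * nb_linked_off f E).
  rewrite -bexpD; apply: eq_bexp => E EP; rewrite -big_split expr2 {1}/nb_linked.
  rewrite mulr_suml; apply: eq_bigr => f fE /=.
  by rewrite (nb_linked_split EP fE) mulrDr -exprS.
rewrite lerD2l {}/M expr2 {2}/nb_linked (bexp_sum_reach (fun k => k%:R)) mulr_suml.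
rewrite bexp_sum_edges; apply: ler_sum => f fP; rewrite -mulrA.
have /andP[p0 _] := p01; apply: ler_wpM2l => //.
have := @exploration_independence (fun k => k%:R) (bexp p (pairs V) nb_linked)
   f (pairs V :\ f) 1 (fun k => ler0n _ k) (subsetDl _ _) _.
rewrite -(bexp_sum_reach (fun k => k%:R)) => hI.
apply: le_trans (le_trans (hI _) _); last by [].
  apply: bexp_le => // E /subsetD1P[EP fE].
  rewrite card_reach_root ?setU11// ?subUset ?sub1set ?fP// setU1K//.
  suff -> : nb_linked_off f (f |: E) = nb_linked_off f E by [].
  have [a [b [ab fab]]] := pairsP _ fP.
  rewrite [X in nb_linked_off _ (X |: _)]fab nb_linked_offU1 -?fab// ?fab ?inE ?eqxx//.
  congr nb_linked_off; apply/setP => x.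
  by rewrite !inE; case: (x == b); rewrite ?orbT.
(* The mean over fewer pairs is no larger, so one bound serves every unrevealed set. *)
move=> D' D'P; apply: bexp_subset => //; last exact: nb_linked_mono.
exact: subset_trans D'P (subsetDl _ _).
Qed.

(** * Lower bound on the mean number of linked pairs *)

Definition crossing A D : {set {set V}} := [set e in D | #|e :&: A| == 1%N].

Lemma card_setX_pairs A B : [disjoint A & B] ->
  #|[set [set x.1; x.2] | x in setX A B]| = (#|A| * #|B|)%N.
Proof.
move=> /disjoint_setI0 AB; rewrite card_in_imset ?cardsX// => -[a b] [a' b'].
rewrite !inE /= => /andP[aA bB] /andP[aA' bB'] ee.
have NAB x : x \in A -> x \in B -> False.
  by move=> xA xB; have := in_set0 x; rewrite -AB inE xA xB.
have : a \in [set a'; b'] by rewrite -ee !inE eqxx.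
rewrite !inE => /orP[/eqP aa|/eqP ab]; last by case: (NAB a) => //; rewrite ab.
have : b \in [set a'; b'] by rewrite -ee !inE eqxx orbT.
rewrite !inE => /orP[/eqP ba|/eqP bb]; first by case: (NAB b) => //; rewrite ba.
by rewrite aa bb.
Qed.

Lemma crossing_pair A u v : u \in A -> v \notin A -> [set u; v] :&: A = [set u].
Proof.
move=> uA vA; apply/setP => x; rewrite !inE.
case: (eqVneq x u) => [->|_]/=; first by rewrite uA.
by case: eqVneq => //= ->; rewrite (negbTE vA).
Qed.

Lemma crossingP A f : f \in pairs V -> #|f :&: A| == 1%N ->
  exists u v, [/\ u \in A, v \notin A & f = [set u; v]].
Proof.
move=> fP /cards1P[u fA]; have : u \in f :&: A by rewrite fA set11.
rewrite inE => /andP[uf uA]; have [v vu fuv] := pair_at fP uf.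
exists u, v; split => //; apply: contraNN vu => vA.
by rewrite -in_set1 -fA fuv !inE eqxx orbT.
Qed.

(* Adding v to A makes the pairs from v to the outside crossing, and only the
   pairs between v and A stop being so. *)
Lemma crossing_step A D u v : [set f in pairs V | [disjoint f & A]] \subset D ->
  D \subset pairs V -> u \in A -> v \notin A ->
  (#|crossing A D| + #|V| <=
   #|crossing (v |: A) (D :\ [set u; v])| + 2 * #|A| + 1)%N.
Proof.
move=> outD DP uA vA.
set C' := crossing (v |: A) _.
pose old := [set [set x.1; x.2] | x in setX A [set v]].
pose new := [set [set x.1; x.2] | x in setX [set v] (~: (v |: A))].
have cold : #|old| = #|A| by rewrite card_setX_pairs ?cards1 ?muln1// disjoint_sym disjoints1.
have cnew : (#|new| + #|A|.+1 = #|V|)%N.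
  rewrite card_setX_pairs ?cards1 ?mul1n; last by rewrite disjoints1 !inE eqxx.
  by rewrite -(cardsC (v |: A)) cardsU1 vA addnC.
have subold : crossing A D \subset (C' :\: new) :|: old.
  apply/subsetP => f; rewrite inE => /andP[fD fc].
  have [a [z [aA zA fab]]] := crossingP (subsetP DP _ fD) fc.
  case: (eqVneq z v) => [zv|zv].
    apply/setUP; right; apply/imsetP; exists (a, v); rewrite ?inE ?aA ?eqxx//=.
    by rewrite fab zv.
  apply/setUP; left; rewrite !inE fD andbT; apply/and3P; split.
  - apply/imsetP => -[[x y]]; rewrite !inE /= => /andP[/eqP -> /norP[yv yA]] fxy.
    have : a \in f by rewrite fab !inE eqxx.
    rewrite fxy !inE => /orP[]/eqP ay; first by rewrite -ay aA in vA.
    by rewrite -ay aA in yA.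
  - apply: contraNneq zv => fuv; have : z \in f by rewrite fab !inE eqxx orbT.
    by rewrite fuv !inE => /orP[/eqP zu|//]; rewrite zu uA in zA.
  - rewrite fab crossing_pair ?cards1//; first by rewrite in_setU1 aA orbT.
    by rewrite in_setU1 negb_or zv.
have subnew : new \subset C'.
  apply/subsetP => f /imsetP[[x z] + ->]; rewrite in_setX in_set1 in_setC /=.
  move=> /andP[/eqP -> zvA]; rewrite inE crossing_pair ?setU11// cards1 andbT in_setD1.
  have /norP[zv zA] : ~~ ((z == v) || (z \in A)) by rewrite -in_setU1.
  apply/andP; split.
    apply: contraNneq zA => fuv; have : u \in [set v; z] by rewrite fuv !inE eqxx.
    by rewrite !inE => /orP[]/eqP uvz; [rewrite -uvz uA in vA|rewrite -uvz].
  apply: (subsetP outD); rewrite !inE cards2 [v == z]eq_sym zv /=.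
  rewrite -setI_eq0; apply/eqP/setP => y; rewrite !inE.
  by apply/negbTE/negP => /andP[/orP[]/eqP->]; rewrite ?(negbTE vA) ?(negbTE zA).
have := leq_trans (subset_leq_card subold) (leq_card_setU _ _).
rewrite cardsD (setIidPr subnew) cold; have := subset_leq_card subnew.
rewrite -cnew; move: #|new| #|C'| #|A| #|crossing A D| => i j k l; lia.
Qed.

(** Revealing one crossing pair at a time, the left side is a submartingale. The growth of the
    square makes up for the pairs between the new vertex and [A] that stop crossing, and the
    equation for [k] balances the loss of the revealed pair against the expected gain. *)
Lemma exploration_lower_bound (k : R) A D : 0 <= k -> k = p * (1 + k * #|V|%:R) ->
  [set f in pairs V | [disjoint f & A]] \subset D -> D \subset pairs V ->
  #|A|%:R + k * (#|crossing A D|%:R + #|A|%:R ^+ 2) <=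
  bexp p D (fun E => #|hull A E|%:R + k * #|hull A E|%:R ^+ 2).
Proof.
move=> k0 kE; elim/bset_ind: D A => D IH A outD DP.
have [D0|[f]] := set_0Vmem (crossing A D).
  rewrite D0 cards0 add0r -[leLHS](bexp_cst p D); apply: bexp_le => // E ED.
  have cA := subset_leq_card (sub_hull A E).
  apply: lerD; rewrite ?ler_nat//; apply: ler_wpM2l => //.
  by rewrite ler_sqr ?nnegrE// ler_nat.
rewrite inE => /andP[fD fA].
have [u [v [uA vA fuv]]] := crossingP (subsetP DP _ fD) fA; subst f.
have DP' : D :\ [set u; v] \subset pairs V by exact: subset_trans (subsetDl _ _) DP.
have step := crossing_step outD DP uA vA.
have cr : #|crossing A D| = (#|crossing A (D :\ [set u; v])|).+1.
  rewrite (cardsD1 [set u; v]) inE fD fA; congr (_.+1); apply: eq_card => f.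
  by rewrite !inE andbA.
have /andP[p0 p1] := p01.
rewrite (bexpD1 _ _ fD).
have h0 : #|A|%:R + k * (#|crossing A (D :\ [set u; v])|%:R + #|A|%:R ^+ 2) <=
    bexp p (D :\ [set u; v]) (fun E => #|hull A E|%:R + k * #|hull A E|%:R ^+ 2).
  apply: IH => //; apply/subsetD1P; split => //.
  rewrite !inE negb_and; apply/orP; right; apply/pred0Pn; exists u.
  by rewrite /= !inE eqxx uA.
have h1 : #|v |: A|%:R + k * (#|crossing (v |: A) (D :\ [set u; v])|%:R + #|v |: A|%:R ^+ 2) <=
    bexp p (D :\ [set u; v]) (fun E => #|hull A ([set u; v] |: E)|%:R
       + k * #|hull A ([set u; v] |: E)|%:R ^+ 2).
  rewrite (eq_bexp p (g := fun E => #|hull (v |: A) E|%:R + k * #|hull (v |: A) E|%:R ^+ 2)).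
    apply: IH => //; apply/subsetD1P; split.
      apply: subset_trans outD; apply/subsetP => f; rewrite !inE => /andP[-> /=].
      by apply: disjointWr; exact: subsetUr.
    rewrite !inE negb_and; apply/orP; right; apply/pred0Pn; exists u.
    by rewrite /= !inE eqxx uA orbT.
  by move=> E _; rewrite hullU1.
move: h0 h1 step; rewrite cr cardsU1 vA /=.
set c0 := #|crossing A _|; set c1 := #|crossing (v |: A) _|; set a := #|A|.
set b0 := bexp _ _ _; set b1 := bexp _ _ _.
rewrite natrD => h0 h1 step0.
have step : c0%:R + #|V|%:R <= c1%:R + 2 * a%:R :> R.
  have : (c0 + #|V| <= c1 + a + a)%N by move: step0; clear; move: #|V| => n; lia.
  by rewrite -(ler_nat R) !natrD; lra.
have h0' := ler_wpM2l (_ : 0 <= 1 - p) h0; have h1' := ler_wpM2l p0 h1.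
have {}h0' := h0' ltac:(lra).
have step' : k * (c0%:R + #|V|%:R) <= k * (c1%:R + 2 * a%:R).
  exact: ler_wpM2l.
have step'' := ler_wpM2l p0 step'.
have pk : 0 <= p * k by exact: mulr_ge0.
rewrite -[c0.+1]addn1 natrD.
nra.
Qed.


(** Starting from the endpoints of an edge, [2 * #|V| - 4] crossing pairs and the square 4 add up to
    [2 * #|V|]. A component with N edges has at most N + 1 vertices. *)
Lemma nb_linked_lower (k : R) : 0 <= k -> k = p * (1 + k * #|V|%:R) ->
  #|pairs V|%:R * p * (1 + 2 * k * #|V|%:R) <=
  bexp p (pairs V) nb_linked +
  4 * k * bexp p (pairs V) (fun E => \sum_(f in E) #|reach f E|%:R ^+ 2).
Proof.
move=> k0 kE; rewrite /nb_linked (bexp_sum_reach (fun k => k%:R)).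
rewrite (bexp_sum_reach (fun k => k%:R ^+ 2)) mulr_sumr -big_split /=.
rewrite -mulrA mulr_natl -sumr_const; have /andP[p0 _] := p01.
apply: ler_sum => f fP; rewrite mulrCA -mulrDr; apply: ler_wpM2l => //.
have [a [b [ab fab]]] := pairsP _ fP.
have outD : [set g in pairs V | [disjoint g & f]] \subset pairs V :\ f.
  apply/subsetP => g; rewrite !inE => /andP[-> gf]; rewrite andbT.
  apply: contraTneq gf => ->; apply/pred0Pn; exists a.
  by rewrite /= fab !inE eqxx.
have := exploration_lower_bound k0 kE outD (subsetDl _ _).
have card2 : #|f| = 2%N by rewrite fab cards2 ab.
have cr : (2 * #|V| <= #|crossing f (pairs V :\ f)| + 4)%N.
  have := @card_setX_pairs f (~: f); rewrite -setI_eq0 setICr eqxx card2 => /(_ isT) cX.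
  have : (#|[set [set x.1; x.2] | x in setX f (~: f)]| <= #|crossing f (pairs V :\ f)|)%N.
    apply/subset_leq_card/subsetP => g /imsetP[[x z]].
    rewrite in_setX in_setC => /andP[/= xf zf] ->.
    rewrite inE crossing_pair// cards1 andbT in_setD1 inE cards2.
    have -> : x != z by apply: contraNneq zf => <-.
    by rewrite andbT; apply: contraNneq zf => <-; rewrite !inE eqxx orbT.
  rewrite cX; have := cardsC f; rewrite card2; lia.
rewrite card2 => h; set b0 := bexp _ _ _; set b1 := bexp _ _ _.
have h2 : bexp p (pairs V :\ f) (fun E => #|hull f E|%:R + k * #|hull f E|%:R ^+ 2) <=
    1 + b0 + 4 * k * b1.
  apply: le_trans (_ : bexp p (pairs V :\ f) (fun E => 1 +
    (#|reach f E|.+1%:R + 4 * k * #|reach f E|.+1%:R ^+ 2)) <= _); last first.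
    by rewrite !bexpD bexpZ bexp_cst addrA.
  apply: bexp_le => // E ED.
  have EP := subset_trans ED (subsetDl _ _).
  have := card_hull f EP; rewrite card2 -(ler_nat R) natrD -[_.+1]addn1 natrD.
  set x := #|hull f E|%:R; set y := #|reach f E|%:R => xy.
  have x0 : 0 <= x by exact: ler0n.
  have y0 : 0 <= y by exact: ler0n.
  have : k * x ^+ 2 <= k * (4 * (y + 1) ^+ 2) by apply: ler_wpM2l => //; nra.
  by rewrite -[4 * k * _]mulrA mulrCA; lra.
move: h cr; rewrite -(ler_nat R) natrD natrM.
move: h2; set c := #|crossing _ _|%:R => h2 h cr.
have h3 : k * (2 * #|V|%:R) <= k * (c + 4) by apply: ler_wpM2l.
by lra.
Qed.

(** * Edges in components of bounded size *)

Definition small_edges K E := [set f in E | (#|reach f E| < K)%N].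

Lemma small_edges_at K E u : E \subset pairs V ->
  (#|[set f in small_edges K E | u \in hull f E]| <= K)%N.
Proof.
move=> EP; case: (set_0Vmem [set f in small_edges K E | u \in hull f E]) => [->|[f]].
  by rewrite cards0.
rewrite inE => /andP[+ uf]; rewrite inE => /andP[fE fK]; apply: leq_trans (ltnW fK).
apply/subset_leq_card/subsetP => g; rewrite inE => /andP[+ ug].
rewrite inE => /andP[gE _]; rewrite inE gE /=.
have [a [b [_ fab]]] := pairsP _ (subsetP EP _ fE).
have af : a \in f by rewrite fab !inE eqxx.
have [c [d [_ gcd]]] := pairsP _ (subsetP EP _ gE).
have cg : c \in g by rewrite gcd !inE eqxx.
apply/pred0Pn; exists c; rewrite /= cg /=; move: uf ug.
rewrite (hull_edge EP fE af) (hull_edge EP gE cg) => /hull1_eq <- /hull1_eq ->.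
by rewrite mem_hull1 connect0.
Qed.

(** A new edge disturbs only the components of its endpoints: at most [K] small edges at each are
    lost, and the only possible gain is the new edge. *)
Lemma small_edges_lipschitz K e E : e \in pairs V -> E \subset pairs V -> e \notin E ->
  `|#|small_edges K (e |: E)|%:R - #|small_edges K E|%:R| <= (2 * K + 1)%:R :> R.
Proof.
move=> /pairsP[u [v [uv ->]]] EP eE.
have up : (#|small_edges K ([set u; v] |: E)| <= #|small_edges K E| + 1)%N.
  apply: (@leq_trans #|[set u; v] |: small_edges K E|); last first.
    by rewrite cardsU1 addnC leq_add2l; case: (_ \notin _).
  apply/subset_leq_card/subsetP => f; rewrite !inE => /andP[/orP[->//|fE] fK].
  rewrite fE orbC /= (leq_ltn_trans _ fK)//; apply/subset_leq_card/reach_mono.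
  exact: subsetUr.
have dn : (#|small_edges K E| <= #|small_edges K ([set u; v] |: E)| + 2 * K)%N.
  have : small_edges K E \subset small_edges K ([set u; v] |: E) :|:
     ([set f in small_edges K E | u \in hull f E] :|:
      [set f in small_edges K E | v \in hull f E]).
    apply/subsetP => f fS; move: (fS); rewrite inE => /andP[fE fK].
    rewrite !in_setU.
    case: (boolP (f \in [set f in small_edges K E | u \in hull f E])) => [_|]; rewrite ?orbT//.
    case: (boolP (f \in [set f in small_edges K E | v \in hull f E])) => [_|]; rewrite ?orbT//.
    rewrite inE fS /= => vf; rewrite inE fS /= => uf.
    by rewrite inE in_setU1 fE orbT reachU_off// fK.
  move=> /subset_leq_card/leq_trans/(_ (leq_card_setU _ _))/leq_trans; apply.
  rewrite leq_add2l mul2n -addnn; apply: leq_trans (leq_card_setU _ _) _.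
  by apply: leq_add; exact: small_edges_at.
move: up dn; rewrite -!(ler_nat R); move: (#|small_edges _ _|) => i.
move: (#|small_edges _ _|) (2 * K)%N => j l; rewrite !natrD ler_norml.
have := ler0n R l; lra.
Qed.

End Exploration.

(** * The modularity of the partition into components *)

Section Modularity.
Variables (V : finType) (G : simple_graph V).
Implicit Types (u v w : V) (A B f : {set V}) (P : {set {set V}}).
Local Notation E := (edges G).

Lemma edges_pairs : E \subset pairs V.
Proof. by apply/subsetP => e eE; rewrite inE (forall_inP (edges_card2 G)). Qed.

Lemma degree_edges v : degree G v = #|[set e in E | v \in e]|.
Proof.
rewrite /degree -(card_imset (f := fun u => [set v; u])); last first.
  move=> x y xy; have : x \in [set v; y] by rewrite -xy !inE eqxx orbT.
  rewrite !inE => /orP[|/eqP//] /eqP xv.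
  have : y \in [set v; x] by rewrite xy !inE eqxx orbT.
  by rewrite xv !inE orbb => /eqP.
apply: eq_card => e; rewrite inE; apply/imsetP/andP => [[u]|[eE ve]].
  by rewrite inE /adj => uvE ->; rewrite uvE !inE eqxx.
have [u _ evu] := pair_at (subsetP edges_pairs _ eE) ve.
by exists u; rewrite // inE /adj -evu.
Qed.

Lemma vol_edges A : vol G A = (\sum_(e in E) #|e :&: A|)%N.
Proof.
rewrite /vol; under eq_bigr => v _ do rewrite degree_edges -sum1dep_card big_mkcondr.
rewrite exchange_big /=; apply: eq_bigr => e _.
by rewrite -big_mkcondr sum1dep_card; apply: eq_card => v; rewrite !inE andbC.
Qed.

Lemma vol_hull A : vol G (hull A E) = (2 * #|reach A E|)%N.
Proof.
rewrite vol_edges (bigID (mem (reach A E))) /= addnC big1 ?add0n; last first.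
  move=> e /andP[eE]; rewrite inE eE /= negbK => /disjoint_setI0 ->.
  by rewrite cards0.
rewrite (eq_bigl (mem (reach A E))); last first.
  by move=> e; rewrite /= !inE; case: (e \in E).
rewrite (eq_bigr (fun _ => 2%N)) ?sum_nat_const 1?mulnC// => e.
rewrite /= inE => /andP[eE /pred0Pn[u /andP[/= ue uA]]].
have [v _ euv] := pair_at (subsetP edges_pairs _ eE) ue.
rewrite (setIidPl _); last first.
  rewrite euv subUset !sub1set uA; apply: hull_closed uA; by rewrite -euv.
by apply/eqP; move: (subsetP edges_pairs _ eE); rewrite inE.
Qed.

Definition cut P := [set e in E | ~~ [exists A in P, e \subset A]].

Lemma sum_edges_within P : finset.partition P setT ->
  (\sum_(A in P) edges_within G A + #|cut P| = #|E|)%N.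
Proof.
move=> /and3P[_ tP P0].
have -> : (\sum_(A in P) edges_within G A)%N = #|[set e in E | [exists A in P, e \subset A]]|.
  rewrite -[RHS]sum1dep_card big_mkcondr /=.
  under eq_bigr => A _ do rewrite /edges_within -sum1dep_card big_mkcondr.
  rewrite exchange_big /=; apply: eq_bigr => e eE.
  case: ifPn => [/exists_inP[A AP eA]|]; last first.
    move=> /exists_inPn h; rewrite big1// => A AP; rewrite ifN//; exact: h.
  rewrite (bigD1 A)//= eA big1 ?addn0// => B /andP[BP BA]; rewrite ifN//.
  apply: contraNN BA => eB; have [u [v [_ euv]]] := pairsP _ (subsetP edges_pairs _ eE).
  have ue : u \in e by rewrite euv !inE eqxx.
  apply/eqP; rewrite -(def_pblock tP BP (subsetP eB _ ue)).
  exact: def_pblock tP AP (subsetP eA _ ue).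
rewrite -cardsUI [X in (_ + X)%N](_ : _ = 0%N) ?addn0.
  by apply: eq_card => e; rewrite !inE -andb_orr orbN andbT.
by apply/eqP; rewrite cards_eq0; apply/eqP/setP => e; rewrite !inE; case: (e \in E) => //=; rewrite andbN.
Qed.

(** Spreading each square over the vertices of its part lets two partitions be compared vertex by
    vertex. *)
Lemma sum_vol_sqr P : finset.partition P setT ->
  (\sum_(A in P) vol G A ^ 2 = \sum_v degree G v * vol G (pblock P v))%N.
Proof.
move=> /and3P[/eqP cP tP P0].
rewrite [RHS](eq_bigl (mem (cover P))) => [|v]; last by rewrite /= cP inE.
rewrite big_trivIset//=; apply: eq_bigr => A AP; rewrite expnS expn1 {1}/vol big_distrl /=.
by apply: eq_bigr => v vA; rewrite (def_pblock tP AP vA).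
Qed.

Lemma pblock_components v : pblock (components G) v = hull [set v] E.
Proof.
apply/setP => w; rewrite mem_hull1.
rewrite pblock_equivalence_partition ?inE//.
move=> x y z _ _ _; split; first exact: connect0.
by move=> cxy; rewrite (same_connect (sym_connect_sym (adj_sym G)) cxy).
Qed.

Lemma cut_components : cut (components G) = set0.
Proof.
apply/setP => e; rewrite !inE; case: (boolP (e \in E)) => //= eE; apply: negbF.
have [u [v [_ euv]]] := pairsP _ (subsetP edges_pairs _ eE).
have cC := components_partition G.
apply/exists_inP; exists (pblock (components G) u).
  by apply: pblock_mem; rewrite (cover_partition cC) inE.
rewrite pblock_components euv subUset !sub1set mem_hull1 connect0 /=.
by rewrite mem_hull1 connect1// /eadj -euv.
Qed.

(** A component with k edges has volume 2k, and k^2 counts the ordered pairs of its edges. *)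
Lemma sum_vol_sqr_components :
  (\sum_(A in components G) vol G A ^ 2 = 4 * \sum_(e in E) #|reach e E|)%N.
Proof.
rewrite sum_vol_sqr ?components_partition// big_distrr /=.
under eq_bigr => v _ do rewrite pblock_components vol_hull degree_edges -sum1dep_card
  big_distrl big_mkcondr.
rewrite exchange_big /=; apply: eq_bigr => e eE; rewrite -big_mkcondr /=.
rewrite (eq_bigr (fun _ => 2 * #|reach e E|)%N) => [|v ve].
  rewrite sum_nat_const; move: (subsetP edges_pairs _ eE); rewrite inE => /eqP ->.
  by rewrite mulnA.
rewrite mul1n; congr (_ * _)%N; apply: eq_card => g.
by rewrite !inE (hull_edge edges_pairs eE ve).
Qed.

(** A walk in the component of [v] that leaves the part of [v] must use a cut edge. *)
Lemma cut_at P v : finset.partition P setT -> ~~ (hull [set v] E \subset pblock P v) ->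
  exists2 e, e \in cut P & v \in hull e E.
Proof.
move=> pP; have /and3P[/eqP cP tP P0] := pP => nsub.
apply/exists_inP; apply: contraNT nsub => /exists_inPn none.
suff : hull [set v] E \subset pblock P v :&: hull [set v] E.
  by rewrite subsetI => /andP[].
have vP u : u \in pblock P u by rewrite mem_pblock cP inE.
apply: hull_min => [|x y xy]; first by rewrite sub1set in_setI vP mem_hull1 connect0.
rewrite !in_setI => /andP[xv xh]; rewrite (hull_closed xy xh) andbT.
have := none [set x; y]; rewrite inE xy hull_pair// (hull1_eq xh) mem_hull1 connect0 /=.
case: (boolP [exists A in P, _]) => [/exists_inP[A AP] + _|_ /(_ isT)//].
rewrite subUset !sub1set => /andP[xA yA].
by rewrite -(same_pblock tP xv) (def_pblock tP AP xA).
Qed.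

Lemma vol_le_pblock P v : finset.partition P setT ->
  (vol G (hull [set v] E) <= vol G (pblock P v) +
    \sum_(e in cut P | v \in hull e E) vol G (hull e E))%N.
Proof.
move=> pP; have [sub|/(cut_at pP)[e eC ve]] := boolP (hull [set v] E \subset pblock P v).
  apply: leq_trans (leq_addr _ _); rewrite /vol [leqRHS](big_setID (hull [set v] E)) /=.
  by rewrite (setIidPr sub) leq_addr.
apply: leq_trans (leq_addl _ _); rewrite (bigD1 e) ?eC//=.
apply: leq_trans (leq_addr _ _); move: eC; rewrite inE => /andP[eE _].
have [a [b [_ eab]]] := pairsP _ (subsetP edges_pairs _ eE).
have ae : a \in e by rewrite eab !inE eqxx.
move: ve; rewrite (hull_edge edges_pairs eE ae) => /hull1_eq ->.
exact: leqnn.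
Qed.

(** By [vol_le_pblock], the excess at a vertex is charged to the cut edges in its component. Summed
    with degrees, each cut edge is charged the squared volume of its component, at most [4 * #|E|]
    by the size condition. *)
Lemma sum_vol_sqr_le P : finset.partition P setT ->
  (forall e, e \in E -> #|reach e E| ^ 2 <= #|E|)%N ->
  (\sum_(A in components G) vol G A ^ 2 <=
   \sum_(A in P) vol G A ^ 2 + 4 * #|E| * #|cut P|)%N.
Proof.
move=> pP small; rewrite !sum_vol_sqr ?components_partition//.
apply: (@leq_trans (\sum_v degree G v * (vol G (pblock P v) +
    \sum_(e in cut P | v \in hull e E) vol G (hull e E)))%N).
  by apply: leq_sum => v _; rewrite pblock_components leq_mul2l vol_le_pblock ?orbT.
under eq_bigr => v _ do rewrite mulnDr.
rewrite big_split /= leq_add2l.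
under eq_bigr => v _ do rewrite big_distrr big_mkcondr.
rewrite exchange_big /=.
apply: (@leq_trans (\sum_(e in cut P) 4 * #|E|)%N); last first.
  by rewrite sum_nat_const mulnC.
apply: leq_sum => e; rewrite inE => /andP[eE _]; rewrite -big_mkcond -big_distrl /=.
rewrite -/(vol G (hull e E)) vol_hull.
by have := small e eE; rewrite expnS expn1; move: #|E| #|reach e E| => i j; nia.
Qed.

End Modularity.

(** * The score of the components partition *)

Section Score.
Variables (R : realType) (V : finType) (G : simple_graph V).
Local Notation E := (edges G).

Lemma mod_scoreE P : mod_score R G P =
  (nb_edges G)%:R^-1 * (\sum_(A in P) edges_within G A)%N%:R
  - (4 * (nb_edges G)%:R ^+ 2)^-1 * (\sum_(A in P) vol G A ^ 2)%N%:R.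
Proof.
rewrite /mod_score !natr_sum; congr (_ - _ * _).
by apply: eq_bigr => A _; rewrite natrX.
Qed.

Lemma mod_score_components : (0 < nb_edges G)%N ->
  mod_score R G (components G) = 1 - nb_linked R E / (nb_edges G)%:R ^+ 2.
Proof.
move=> m0; have mR0 : (nb_edges G)%:R != 0 :> R by rewrite pnatr_eq0 -lt0n.
rewrite mod_scoreE.
have := sum_edges_within G (components_partition G); rewrite cut_components cards0 addn0 => ->.
rewrite sum_vol_sqr_components natrM natr_sum -/(nb_linked R E) -/(nb_edges G).
by field.
Qed.

(** With m edges, each cut edge loses 1/m in the first term of the score and recovers at most
    4m/(4m^2) in the second. *)
Lemma modularity_components : (0 < nb_edges G)%N ->
  (forall e, e \in E -> #|reach e E| ^ 2 <= #|E|)%N ->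
  modularity R G = mod_score R G (components G).
Proof.
move=> m0 small; apply/eqP; rewrite eq_le modularity_ub ?components_partition// andbT.
have [P pP ->] := modularity_attained R G.
have mR0 : 0 < (nb_edges G)%:R :> R by rewrite ltr0n.
have := sum_vol_sqr_le pP small; have := sum_edges_within G pP.
have := sum_edges_within G (components_partition G); rewrite cut_components cards0 addn0.
rewrite !mod_scoreE => -> h1; move: h1; rewrite -/(nb_edges G).
set m := nb_edges G; set a := (\sum_(A in P) edges_within G A)%N; set c := #|cut G P|.
set x := (\sum_(A in P) _)%N; set y := (\sum_(A in components G) _)%N => h1 h2.
have {}h1 : a%:R = m%:R - c%:R :> R by rewrite -h1 natrD addrK.
move: h2; rewrite -(ler_nat R) natrD !natrM h1 => h2.
rewrite -subr_ge0.
have -> : m%:R^-1 * m%:R - (4 * m%:R ^+ 2)^-1 * y%:R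
   - (m%:R^-1 * (m%:R - c%:R) - (4 * m%:R ^+ 2)^-1 * x%:R) =
   (x%:R + 4 * m%:R * c%:R - y%:R) / (4 * m%:R ^+ 2) :> R by field; rewrite gt_eqF.
by rewrite divr_ge0 ?subr_ge0// mulr_ge0// sqr_ge0.
Qed.

End Score.

From mathcomp Require Import all_classical topology normedtype sequences.
From mathcomp Require Import derive realfun exp.

Import numFieldNormedType.Exports.

Local Open Scope classical_set_scope.
Local Open Scope ring_scope.

(** * Exponential estimates *)

Section Exponentials.
Variable R : realType.
Implicit Types x y : R.

(* The derivative of (1 + x) exp(x^2/2 - x) is x^2 exp(x^2/2 - x). *)
Lemma expR_quad_mono x y : x <= y ->
  (1 + x) * expR (x ^+ 2 / 2 - x) <= (1 + y) * expR (y ^+ 2 / 2 - y).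
Proof.
move=> xy; pose g (t : R) := (1 + t) * expR (t ^+ 2 / 2 - t).
have dg : forall t : R, is_derive t (1 : R) g (t ^+ 2 * expR (t ^+ 2 / 2 - t)).
  by move=> t; rewrite /g; apply: is_derive_eq; rewrite /GRing.scale /=; field.
have cg : continuous g.
  move=> t; have dt := @ex_derive _ _ _ _ _ _ _ (dg t).
  exact/differentiable_continuous/derivable1_diffP/dt.
have [c _ e] := MVT_segment xy (fun t _ => dg t) (continuous_subspaceT cg).
suff : g x <= g y by []; rewrite -subr_ge0 e.
by apply: mulr_ge0; rewrite ?subr_ge0//; apply: mulr_ge0; rewrite ?expR_ge0// sqr_ge0.
Qed.

Lemma expR_quad x : 0 <= x -> expR (x - x ^+ 2 / 2) <= 1 + x.
Proof.
move=> /expR_quad_mono; rewrite expr0n /= mul0r subr0 expR0 addr0 mulr1 => h.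
have e : expR (x ^+ 2 / 2 - x) * expR (x - x ^+ 2 / 2) = 1.
  by rewrite -expRD addrA subrK subrr expR0.
by have := ler_wpM2r (expR_ge0 (x - x ^+ 2 / 2)) h; rewrite mul1r -[leRHS]mulrA e mulr1.
Qed.

Lemma expR_quadN x : 0 <= x -> 1 - x <= expR (- x - x ^+ 2 / 2).
Proof.
rewrite -oppr_le0 => /expR_quad_mono; rewrite expr0n /= mul0r subr0 expR0 addr0 mulr1 => h.
have e : expR ((- x) ^+ 2 / 2 - - x) * expR (- x - x ^+ 2 / 2) = 1.
  by rewrite -expRD -[RHS](expR0 R); congr expR; ring.
by have := ler_wpM2r (expR_ge0 (- x - x ^+ 2 / 2)) h; rewrite mul1r -[leLHS]mulrA e mulr1.
Qed.

(** Squaring exp(-x/2) >= 1 - x/2 bounds exp x by (1 - x/2)^(-2); the factorization [h3] compares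
    this with 1 + 3x. *)
Lemma expR_le_linear x : 0 <= x <= 1 -> expR x <= 1 + 3 * x.
Proof.
move=> /andP[x0 x1]; have := expR_ge1Dx (- (x / 2)) => h.
have e2 : expR x = expR (- (x / 2)) ^- 2.
  by rewrite -exprVn -expRN opprK -expRM_natl; congr expR; field.
rewrite e2 -lef_pV2 ?posrE ?invr_gt0 ?exprn_gt0 ?expR_gt0 ?invrK//; last by lra.
rewrite -div1r ler_pdivrMr; last by lra.
have h2 : (1 - x / 2) ^+ 2 <= expR (- (x / 2)) ^+ 2 by rewrite ler_sqr ?nnegrE ?expR_ge0//; lra.
have h3 : (1 + 3 * x) * (1 - x / 2) ^+ 2 = 1 + x * (1 - x) * (2 - 3 / 4 * x) by field.
have h4 : 0 <= x * (1 - x) * (2 - 3 / 4 * x) by rewrite !mulr_ge0//; lra.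
have h5 : 0 <= 1 + 3 * x by lra.
have := ler_wpM2l h5 h2; lra.
Qed.


Lemma bernoulli_ineq x (n : nat) : 0 <= 1 + x -> 1 + n%:R * x <= (1 + x) ^+ n.
Proof.
move=> x0; elim: n => [|n IH]; first by rewrite mul0r addr0.
rewrite exprS -addn1 natrD; apply: le_trans (ler_wpM2l x0 IH).
have : 0 <= n%:R * x ^+ 2 by rewrite mulr_ge0// sqr_ge0.
lra.
Qed.

Lemma ler_1DxX x (n : nat) : 0 <= 1 + x -> (1 + x) ^+ n <= expR (n%:R * x).
Proof.
by move=> x0; rewrite expRM_natl; apply: lerXn2r; rewrite ?nnegrE ?expR_ge0 ?expR_ge1Dx.
Qed.

Lemma expR_le_1BxX x (n : nat) : 0 <= x <= 1 / 2 ->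
  expR (- (n%:R * (x + 2 * x ^+ 2))) <= (1 - x) ^+ n.
Proof.
move=> /andP[x0 x2]; rewrite -mulrN expRM_natl.
apply: lerXn2r; rewrite ?nnegrE ?expR_ge0//; first lra.
rewrite expRN -[leRHS]invrK lef_pV2 ?posrE ?invr_gt0 ?expR_gt0//; last lra.
apply: le_trans (expR_ge1Dx _).
rewrite -div1r ler_pdivrMr; last lra.
have : 0 <= x ^+ 2 * (1 - 2 * x) by rewrite mulr_ge0 ?sqr_ge0//; lra.
have -> : (1 + (x + 2 * x ^+ 2)) * (1 - x) = 1 + x ^+ 2 * (1 - 2 * x) by ring.
lra.
Qed.

End Exponentials.

(** * Differences of two exponentials along the exploration *)

Section RootedExponential.
Variables (R : realType) (n : nat) (p : R).
Hypothesis p01 : 0 <= p <= 1.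

(** The recursion conditions make [lam ^+ s * X ^+ r] a supersolution and [mu ^+ s * Y ^+ r] a
    subsolution, so their difference is a supersolution; the ordering of the parameters makes it
    nondecreasing in [r]. *)
Lemma rooted_exp (lam X mu Y : R) : 1 <= X -> 0 < Y <= X -> 0 < mu <= lam ->
  1 - p + p * (lam * X ^+ n) <= X -> Y <= 1 - p + p * (mu * Y ^+ n) ->
  bexp p (pairs 'I_n) (fun E => \sum_(f in E) (lam ^+ #|reach f E| - mu ^+ #|reach f E|)) <=
  #|pairs 'I_n|%:R * p * (lam * X ^+ (2 * n) - mu * Y ^+ (2 * n)).
Proof.
move=> X1 /andP[Y0 YX] /andP[mu0 mulam] HX HY.
have X0 : 0 < X by exact: lt_le_trans X1.
have lam0 : 0 < lam by exact: lt_le_trans mulam.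
have pw s r : mu ^+ s * Y ^+ r <= lam ^+ s * X ^+ r.
  by apply: ler_pM; rewrite ?exprn_ge0 ?(ltW mu0) ?(ltW Y0)//;
     apply: lerXn2r => //; rewrite nnegrE ltW.
have pwX s r : 0 <= lam ^+ s * X ^+ r by rewrite mulr_ge0 ?exprn_ge0// ltW.
have pwY s r : 0 <= mu ^+ s * Y ^+ r by rewrite mulr_ge0 ?exprn_ge0// ltW.
have := @rooted_bound R 'I_n p p01 (fun s => lam ^+ s - mu ^+ s)
  (fun s r => lam ^+ s * X ^+ r - mu ^+ s * Y ^+ r).
rewrite !expr1 card_ord; apply.
- by move=> s; rewrite !expr0 !mulr1.
- move=> s r r' /subnK <-; elim: (r' - r)%N => {r'}// k; rewrite addSn => /le_trans; apply.
  have := pw s (k + r)%N; have := pwX s (k + r)%N; have := pwY s (k + r)%N.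
  rewrite !exprSr !mulrA; set a := _ * X ^+ _; set b := _ * Y ^+ _ => b0 a0 ba.
  have h1 : 0 <= a * (X - 1) by rewrite mulr_ge0// subr_ge0.
  have h2 : b * (Y - 1) <= a * (X - 1).
    have [Y1|/ltW Y1] := leP 1 Y.
      by apply: ler_pM; rewrite ?subr_ge0// lerB.
    by apply: le_trans h1; rewrite mulr_ge0_le0// subr_le0.
  lra.
- move=> s r.
  have h1 := ler_wpM2l (pwX s r) HX; have h2 := ler_wpM2l (pwY s r) HY.
  rewrite !exprD !exprSr; move: h1 h2.
  set a := lam ^+ s; set b := X ^+ r; set c := mu ^+ s; set d := Y ^+ r.
  set e := X ^+ n; set g := Y ^+ n => h1 h2.
  lra.
Qed.

End RootedExponential.

(** * Estimates for a fixed number of vertices *)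

Section Transfer.
Variables (R : realType) (n : nat) (p : R).

Lemma gnp_bexp (g : {set {set 'I_n}} -> R) :
  \sum_G gnp_weight p G * g (edges G) = bexp p (pairs 'I_n) g.
Proof.
have G0P : [forall e in (finset.set0 : {set {set 'I_n}}), #|e| == 2].
  by apply/forall_inP => e; rewrite inE.
rewrite /bexp (reindex_onto (@edges 'I_n) (insubd (SimpleGraph G0P))) /=; last first.
  move=> E; rewrite powersetE => /fintype.subsetP EP.
  rewrite -[LHS]/(val _) val_insubd ifT//.
  by apply/forall_inP => e /EP; rewrite inE.
apply: eq_big => [G|G _]; last first.
  by congr (_ * _); apply: eq_bigl => e; rewrite inE.
symmetry; rewrite powersetE edges_pairs /=; apply/eqP/val_inj.
by rewrite val_insubd edges_card2.
Qed.

Lemma gnp_pr_lower (P : pred (simple_graph 'I_n)) (Q : pred {set {set 'I_n}}) :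
  0 <= p <= 1 -> (forall G, ~~ Q (edges G) -> P G) ->
  1 - bexp p (pairs 'I_n) (fun E => (Q E)%:R) <= gnp_pr p P <= 1.
Proof.
move=> p01 QP.
have w0 (G : simple_graph 'I_n) : 0 <= gnp_weight p G.
  by apply: prodr_ge0 => e _; case: ifP => _; move: p01 => /andP[]; lra.
have tot := gnp_pr_total n p; rewrite /gnp_pr in tot.
have split : \sum_(G : simple_graph 'I_n) gnp_weight p G =
    gnp_pr p P + \sum_(G | ~~ P G) gnp_weight p G by rewrite (bigID P).
have tot1 : \sum_(G : simple_graph 'I_n) gnp_weight p G = 1 by rewrite -[RHS]tot; apply: eq_bigl.
have neg0 : 0 <= \sum_(G | ~~ P G) gnp_weight p G by exact: sumr_ge0.
have negQ : \sum_(G | ~~ P G) gnp_weight p G <= bexp p (pairs 'I_n) (fun E => (Q E)%:R).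
  rewrite -gnp_bexp [leLHS]big_mkcond; apply: ler_sum => G _.
  case: ifP => [nP|_]; last by rewrite mulr_ge0.
  by case: (boolP (Q (edges G))) => [_|/QP PG]; [rewrite mulr1|rewrite PG in nP].
rewrite split in tot1; lra.
Qed.

End Transfer.

(** It suffices to exhibit a bad event of vanishing probability outside which the property holds
    deterministically. *)
Lemma whp_of_bexp (R : realType) (p : nat -> R) (P : forall n, pred (simple_graph 'I_n))
    (Q : forall n, pred {set {set 'I_n}}) :
  (forall n, (0 < n)%N -> 0 < p n <= 1) ->
  (forall eps : R, 0 < eps -> \forall n \near \oo,
     (forall G, ~~ Q n (edges G) -> P n G) /\
     bexp (p n) (pairs 'I_n) (fun E => (Q n E)%:R) <= eps) ->
  whp p P.
Proof.
move=> p01 h; apply/cvgrPdist_le => eps eps0.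
near=> n.
have [QP Qe] : (forall G, ~~ Q n (edges G) -> P n G) /\
     bexp (p n) (pairs 'I_n) (fun E => (Q n E)%:R) <= eps by near: n; exact: h.
have n0 : (0 < n)%N by near: n; exact: nbhs_infty_gt.
have /andP[p0 p1] := p01 n n0.
have pp : 0 <= p n <= 1 by rewrite (ltW p0).
have /andP[lo hi] := gnp_pr_lower pp QP.
by rewrite ger0_norm ?subr_ge0//; lra.
Unshelve. all: by end_near. Qed.

(** * Concentration of edge counts, matchings and exponential moments *)

Section FixedSize.
Variables (R : realType) (n : nat) (p : R).
Hypothesis p01 : 0 <= p <= 1.
Local Notation E_ := (bexp p (pairs 'I_n)).
Let a := #|pairs 'I_n|%:R * p.

Lemma expected_edges_ge0 : 0 <= a.
Proof. by rewrite mulr_ge0//; case/andP: p01. Qed.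

Lemma bexp_card : E_ (fun E => #|E|%:R) = a.
Proof.
transitivity (E_ (fun E => \sum_(f in E) 1)).
  by apply: eq_bexp => E _; rewrite sumr_const.
rewrite (bexp_sum_edges p (fun _ _ => 1)) (eq_bigr (fun _ => p)).
  by rewrite sumr_const /a mulr_natl.
by move=> f _; rewrite bexp_cst mulr1.
Qed.

Lemma concentration_card (t : R) : 0 < t ->
  E_ (fun E => (t <= `|#|E|%:R - a|)%R%:R) <= a / t ^+ 2.
Proof.
move=> t0; rewrite -bexp_card; apply: le_trans (bexp_chebyshev p01 _ _ t0) _.
rewrite bexp_card ler_pM2r ?invr_gt0 ?exprn_gt0//.
have -> : a = #|pairs 'I_n|%:R * p * 1 ^+ 2 by rewrite expr1n mulr1.
apply: bvar_lipschitz => // e E _ _ eE.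
by rewrite cardsU1 eE natrD addrK normr1.
Qed.

Lemma concentration_small K (t : R) : 0 < t ->
  E_ (fun E => (t <= `|#|small_edges K E|%:R - E_ (fun E => #|small_edges K E|%:R)|)%R%:R)
  <= a * (2 * K + 1)%:R ^+ 2 / t ^+ 2.
Proof.
move=> t0; apply: le_trans (bexp_chebyshev p01 _ _ t0) _.
rewrite ler_pM2r ?invr_gt0 ?exprn_gt0//.
by apply: bvar_lipschitz => // e E eP EP eE; exact: small_edges_lipschitz.
Qed.

(** Markov's inequality with multiplicity: a component with k edges contributes [h k] once for each
    of its edges. *)
Lemma exists_reach_bound (Q : pred nat) (h : nat -> R) (B : R) : 0 < B ->
  (forall k, 0 <= h k) -> (forall k, Q k -> B <= k%:R * h k) ->
  E_ (fun E => [exists f in E, Q #|reach f E|]%:R) <=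
  E_ (fun E => \sum_(f in E) h #|reach f E|) / B.
Proof.
move=> B0 h0 hQ; apply: bexp_markov => // [E _|E EP]; first exact: sumr_ge0.
case/exists_inP => f fE /hQ/le_trans; apply.
rewrite (big_setID (reach f E)) /= ler_wpDr ?sumr_ge0//.
rewrite (finset.setIidPr _); last by apply/fintype.subsetP => g; rewrite inE => /andP[].
rewrite (eq_bigr (fun _ => h #|reach f E|)) => [|g /(reach_eq EP fE) ->//].
by rewrite sumr_const mulr_natl.
Qed.

Lemma matching_bound : n%:R * p <= 1 / 2 ->
  E_ (fun E => [exists f in E, (1 < #|reach f E|)%N]%:R) <= 4 * n%:R * p * a.
Proof.
move=> np2; set d := 1 - n%:R * p; have d0 : 0 < d by rewrite /d; lra.
have /andP[p0 p1] := p01.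
(* With this slope, [s%:R - 1 + k * r%:R] satisfies the exploration recursion with equality. *)
pose k := p / d; have kE : k = p * (1 + k * n%:R).
  by rewrite /k /d; field; rewrite -/d gt_eqF.
have k0 : 0 <= k by rewrite divr_ge0// ltW.
apply: le_trans (exists_reach_bound (h := fun s => s.-1%:R) (B := 1) _ _ _) _ => //.
  by move=> [|[|s]]// _; rewrite -natrM ler1n.
rewrite divr1.
rewrite (eq_bexp p (g := fun E => \sum_(f in E) (#|reach f E|%:R - 1))); last first.
  move=> E EP; apply: eq_bigr => f fE.
  by rewrite card_reach_root// -[in RHS]addn1 natrD addrK.
have := @rooted_bound R 'I_n p p01 (fun s => s%:R - 1)
   (fun s r => s%:R - 1 + k * r%:R).
rewrite card_ord => /(_ _ _ _)/le_trans; apply.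
- by move=> s; rewrite mulr0 addr0.
- by move=> s r r' rr; rewrite lerD2l ler_wpM2l// ler_nat.
- move=> s r; rewrite -[r.+1]addn1 -[s.+1]addn1 !natrD -subr_ge0.
  rewrite [leRHS](_ : _ = k - p * (1 + k * n%:R)); last by ring.
  by rewrite -kE subrr.
rewrite subrr add0r natrM -/a mulrC; apply: ler_wpM2r; first exact: expected_edges_ge0.
have k2 : k <= 2 * p.
  have h : 0 <= p * (2 * d - 1) by rewrite mulr_ge0// /d; lra.
  by rewrite /k ler_pdivrMr//; lra.
have : n%:R * k <= n%:R * (2 * p) by apply: ler_wpM2l.
lra.
Qed.

(* With lam = exp (d^2/2) and X = 1 + p d, the bound exp (d - d^2/2) <= 1 + d
   makes lam^s X^r a supersolution of the exploration recursion. *)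
Lemma exp_moment (d : R) : 0 < d -> d = 1 - n%:R * p ->
  E_ (fun E => \sum_(f in E) (expR (d ^+ 2 / 2) ^+ #|reach f E| - 1)) <= 7 * a * d.
Proof.
move=> d0 dE; have /andP[p0 p1] := p01.
have np0 : 0 <= n%:R * p by rewrite mulr_ge0.
have d1 : d <= 1 by lra.
have pd0 : 0 <= p * d by rewrite mulr_ge0// ltW.
have Xn : (1 + p * d) ^+ n <= expR (n%:R * p * d).
  by rewrite -mulrA; apply: ler_1DxX; lra.
have lamX : expR (d ^+ 2 / 2) * (1 + p * d) ^+ n <= 1 + d.
  apply: le_trans (expR_quad (ltW d0)).
  have -> : d - d ^+ 2 / 2 = d ^+ 2 / 2 + n%:R * p * d by rewrite dE; field.
  by rewrite expRD ler_wpM2l// expR_ge0.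
have X1 : 1 <= 1 + p * d by lra.
have lam1 : (0 : R) < 1 <= expR (d ^+ 2 / 2).
  by rewrite ltr01 (le_trans _ (expR_ge1Dx _))// lerDl divr_ge0 ?sqr_ge0.
have HX : 1 - p + p * (expR (d ^+ 2 / 2) * (1 + p * d) ^+ n) <= 1 + p * d.
  by have := ler_wpM2l p0 lamX; lra.
(* The comparison pair [mu = Y = 1] satisfies its recursion with equality and subtracts the constant
   1. *)
have HY : 1 <= 1 - p + p * (1 * 1 ^+ n) by rewrite expr1n !mulr1 subrK.
have Y1 : (0 : R) < 1 <= 1 + p * d by rewrite ltr01.
apply: le_trans (le_trans (rooted_exp p01 X1 Y1 lam1 HX HY) _).
  apply: bexp_le => // E _; apply: ler_sum => f _; by rewrite expr1n.
rewrite expr1n mulr1.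
rewrite -/a [leRHS](_ : _ = a * (7 * d)); last by ring.
apply: ler_wpM2l; first exact: expected_edges_ge0.
rewrite mul2n -addnn exprD mulrA lerBlDr.
apply: le_trans (_ : (1 + d) * expR d <= _).
  apply: ler_pM => //; rewrite ?mulr_ge0 ?expR_ge0 ?exprn_ge0//; try lra.
  by apply: le_trans Xn _; rewrite ler_expR ler_piMl//; lra.
have := @expR_le_linear R d; rewrite (ltW d0) d1 => /(_ isT) h.
have := ler_wpM2l (_ : 0 <= 1 + d) h; nra.
Qed.

(** One Taylor term of the exponential moment is kept. *)
Lemma moment_bound (d : R) (j : nat) : 0 < d -> d = 1 - n%:R * p ->
  (d ^+ 2 / 2) ^+ j.+1 / j.+1`!%:R * E_ (fun E => \sum_(f in E) #|reach f E|%:R ^+ j.+1)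
  <= 7 * a * d.
Proof.
move=> d0 dE; apply: le_trans (exp_moment d0 dE); rewrite -bexpZ.
apply: bexp_le => // E _; rewrite mulr_sumr; apply: ler_sum => f _.
rewrite lerBrDl -expRM_natl.
apply: le_trans (expR_ge1Dxn j _); last by rewrite mulr_ge0// divr_ge0 ?sqr_ge0.
by rewrite lerD2l [(_ * (d ^+ 2 / 2)) ^+ _]exprMn; lra.
Qed.

End FixedSize.

(** * Moments, concentration and largest component below criticality *)

Section Subcritical.
Variables (R : realType) (n : nat) (p d : R).
Hypothesis p01 : 0 <= p <= 1.
Hypothesis d0 : 0 < d.
Hypothesis dE : d = 1 - n%:R * p.
Local Notation E_ := (bexp p (pairs 'I_n)).
Local Notation N f E := #|reach (f : {set 'I_n}) E|.
Local Notation S_ j := (E_ (fun E => \sum_(f in E) (N f E)%:R ^+ j)).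
Local Notation X_ := (@nb_linked R 'I_n).
Variable a : R.
Hypothesis aE : a = #|pairs 'I_n|%:R * p.

Lemma moment1 : d * E_ X_ <= 14 * a.
Proof.
have := moment_bound p01 0 d0 dE; rewrite -aE expr1 divr1.
rewrite (eq_bexp p (f := fun E => \sum_(f in E) _ ^+ 1) (g := X_)) => [|E _]; last first.
  by apply: eq_bigr => f _; rewrite expr1.
rewrite [leLHS](_ : _ = (d * E_ X_ / 2) * d); last by field.
by rewrite ler_pM2r//; lra.
Qed.

Lemma moment2 : d ^+ 3 * S_ 2 <= 56 * a.
Proof.
have := moment_bound p01 1 d0 dE; rewrite -aE (_ : 2`!%:R = 2)//.
rewrite [leLHS](_ : _ = (d ^+ 3 * S_ 2 / 8) * d); last by field.
by rewrite ler_pM2r//; lra.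
Qed.

Lemma moment3 : d ^+ 5 * S_ 3 <= 336 * a.
Proof.
have := moment_bound p01 2 d0 dE; rewrite -aE (_ : 3`!%:R = 6)//.
rewrite [leLHS](_ : _ = (d ^+ 5 * S_ 3 / 48) * d); last by field.
by rewrite ler_pM2r//; lra.
Qed.

(** Multiplied by [d], the bound of [nb_linked_lower] with [k = p / d] reads
    [a * (2 - d) <= d * E_ X_ + 4 * p * S_ 2]; the hypothesis and [moment2] make the last term at
    most [a / 2]. *)
Lemma mean_nb_linked_lower : 8 * (56 * p) <= d ^+ 3 -> a <= 2 * d * E_ X_.
Proof.
move=> pd; have a0 : 0 <= a by rewrite aE; exact: expected_edges_ge0.
have /andP[p0 p1] := p01.
pose k := p / d.
have k0 : 0 <= k by rewrite divr_ge0// ltW.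
have kE : k = p * (1 + k * #|'I_n|%:R).
  by rewrite /k card_ord -[RHS]mulr1 -(divff (lt0r_neq0 d0)) {2}dE; field; rewrite gt_eqF.
have := @nb_linked_lower R 'I_n p p01 k k0 kE; rewrite card_ord -aE => h.
have {}h := ler_wpM2r (ltW d0) h.
have e1 : a * (1 + 2 * k * n%:R) * d = a * (2 - d).
  have -> : 2 - d = d + 2 * (n%:R * p) by rewrite dE; ring.
  by rewrite /k; field; rewrite gt_eqF.
have e2 : (E_ X_ + 4 * k * S_ 2) * d = d * E_ X_ + 4 * p * S_ 2.
  by rewrite /k; field; rewrite gt_eqF.
rewrite {}e1 {}e2 in h; clear k k0 kE.
have h4 : 4 * p * S_ 2 <= a / 2.
  have s0 : 0 <= S_ 2 by apply: bexp_ge0 => // E _; apply: sumr_ge0 => f _; exact: sqr_ge0.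
  rewrite -(ler_pM2l (exprn_gt0 3 d0)).
  rewrite [leLHS](_ : _ = 4 * p * (d ^+ 3 * S_ 2)); last by ring.
  apply: le_trans (_ : 4 * p * (56 * a) <= _).
    by apply: ler_wpM2l moment2; rewrite mulr_ge0.
  rewrite [leLHS](_ : _ = 8 * (56 * p) * (a / 2)); last by field.
  by apply: ler_wpM2r => //; rewrite divr_ge0.
clear pd; have d1 : d <= 1 by rewrite dE; have := mulr_ge0 (ler0n R n) p0; lra.
have : a * 1 <= a * (2 - d) by apply: ler_wpM2l => //; lra.
lra.
Qed.

(** Chebyshev at half the mean: the variance is at most [336 * a / d ^+ 5] by [moment3], and the
    mean at least [a / (2 * d)]. *)
Lemma concentration_nb_linked : 0 < a -> 8 * (56 * p) <= d ^+ 3 ->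
  E_ (fun E => (E_ X_ / 2 <= `|X_ E - E_ X_|)%R%:R) <= 16 * 336 / (a * d ^+ 3).
Proof.
move=> ap pd; have lo := mean_nb_linked_lower pd.
have Xp : 0 < E_ X_.
  rewrite -(pmulr_rgt0 _ (_ : 0 < 2 * d)); last by rewrite mulr_gt0.
  exact: lt_le_trans lo.
have X2 : 0 < E_ X_ / 2 by rewrite divr_gt0.
apply: le_trans (bexp_chebyshev p01 _ _ X2) _.
rewrite ler_pdivrMr ?exprn_gt0//.
apply: le_trans (bvar_nb_linked 'I_n p01) _.
have d30 : 0 < d ^+ 3 by rewrite exprn_gt0.
rewrite -(ler_pM2l (exprn_gt0 5 d0)); apply: le_trans moment3 _.
have -> : d ^+ 5 * (16 * 336 / (a * d ^+ 3) * (E_ X_ / 2) ^+ 2) =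
   336 / a * (2 * d * E_ X_) ^+ 2 by field; rewrite !gt_eqF.
rewrite mulrAC ler_pdivlMr//.
have h : a ^+ 2 <= (2 * d * E_ X_) ^+ 2.
  by rewrite ler_sqr ?nnegrE ?(ltW ap)// (le_trans (ltW ap)).
by lra.
Qed.

(** A component with k edges contributes k^4 to the sum of cubes over edges, whose mean is of order
    [a] when [d] is bounded below. *)
Lemma component_bound_far : 0 < a -> 1 / 10 <= d ->
  E_ (fun E => [exists f in E, 9 / 10 * a < (N f E)%:R ^+ 2]%:R) <=
  2 * 336 * 10 ^+ 5 / a.
Proof.
move=> ap dfar; have B0 : 0 < (9 / 10 * a) ^+ 2 by apply: exprn_gt0; lra.
apply: le_trans (@exists_reach_bound R n p p01 (fun k => 9 / 10 * a < k%:R ^+ 2)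
   (fun k => k%:R ^+ 3) _ B0 _ _) _.
- by move=> k; rewrite exprn_ge0.
- move=> k /ltW hk; rewrite -exprS (exprM _ 2 2).
  by rewrite ler_sqr ?nnegrE ?exprn_ge0//; lra.
rewrite ler_pdivrMr//.
have s0 : 0 <= S_ 3 by apply: bexp_ge0 => // E _; apply: sumr_ge0 => f _; rewrite exprn_ge0.
have h : (1 / 10) ^+ 5 * S_ 3 <= 336 * a.
  apply: le_trans moment3; apply: ler_wpM2r => //; apply: lerXn2r => //; by rewrite nnegrE ?(ltW d0) ?divr_ge0.
have -> : 2 * 336 * 10 ^+ 5 / a * (9 / 10 * a) ^+ 2 = 10 ^+ 5 * (336 * a) * (81 / 50).
  by field; rewrite gt_eqF.
have {}h := ler_wpM2l (exprn_ge0 5 (ler0n R 10)) h.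
rewrite mulrA -exprMn (_ : 10 * (1 / 10) = 1) ?expr1n ?mul1r in h; last by field.
apply: le_trans h _; rewrite ler_peMr ?mulr_ge0 ?exprn_ge0 ?(ltW ap)//.
by lra.
Qed.

(* Here w = n^(1/20) and t = n^(-1/4).  The two exponentials lam^k - mu^k cancel
   to first order; the gain of a factor t, together with the factor k coming from
   counting each large component k times, makes the bound tend to 0. *)
Lemma component_bound_near (w t : R) : 0 < w -> n%:R = w ^+ 20 -> t * w ^+ 5 = 1 ->
  2 * t <= d -> d <= 1 / 10 -> w ^+ 6 <= expR (3 / 10 * w ^+ 10 * d ^+ 2) ->
  2 / 5 * n%:R <= a -> a <= n%:R / 2 ->
  E_ (fun E => [exists f in E, 9 / 10 * a < (N f E)%:R ^+ 2]%:R) <= 18 / w.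
Proof.
move=> w0 nw tw td dnear ew alo ahi; have /andP[p0 p1] := p01.
have t0 : 0 < t by rewrite -(pmulr_lgt0 _ (exprn_gt0 5 w0)) tw.
pose c := n%:R * p; have cE : c = 1 - d by rewrite dE /c; ring.
pose x := 1 + d - t; pose y := 1 + d - 2 * t.
pose X := 1 + p * (d - t); pose Y := 1 + p * (d - 2 * t).
have pt0 : 0 <= p * t by rewrite mulr_ge0// ltW.
have pt1 : p * t <= 1.
  have : p * t <= 1 * t by apply: ler_wpM2r => //; exact: ltW.
  lra.
have pd2 : 0 <= p * (d - 2 * t) by rewrite mulr_ge0//; lra.
have X1 : 1 <= X by rewrite /X; nra.
have Y1 : 1 <= Y by rewrite /Y; lra.
have YX : Y <= X by rewrite /Y /X; lra.
have X0 : 0 < X by lra.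
have Y0 : 0 < Y by lra.
have Xn0 : 0 < X ^+ n by rewrite exprn_gt0.
have Yn0 : 0 < Y ^+ n by rewrite exprn_gt0.
have y0 : 0 < y by rewrite /y; lra.
have YXn : (1 - c * t) * X ^+ n <= Y ^+ n.
  apply: le_trans (_ : (1 - p * t) ^+ n * X ^+ n <= _).
    apply: ler_wpM2r; first exact: ltW.
    by have := @bernoulli_ineq R (- (p * t)) n; rewrite mulrN mulrA; apply; lra.
  rewrite -exprMn; apply: lerXn2r; rewrite ?nnegrE ?mulr_ge0 ?(ltW X0) ?(ltW Y0)//; first lra.
  have : 0 <= p * t * (X - 1) by rewrite mulr_ge0//; lra.
  have -> : Y = X - p * t by rewrite /Y /X; ring.
  lra.
(* Chosen so that [lam * X ^+ n = x] and [mu * Y ^+ n = y], which turns both recursion conditions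
   into equalities. *)
pose lam := x / X ^+ n; pose mu := y / Y ^+ n.
have mu0 : 0 < mu by rewrite divr_gt0.
(* The first-order terms cancel: [x * (1 - c * t)] exceeds [y] by only [t * d ^+ 2 + c * t ^+ 2]. *)
have ratio : (1 + t ^+ 2 / 2) * mu <= lam.
  rewrite /mu /lam mulrA ler_pdivrMr// [leRHS]mulrAC ler_pdivlMr//.
  apply: le_trans (_ : x * ((1 - c * t) * X ^+ n) <= _); last first.
    by apply: ler_wpM2l => //; rewrite /x; lra.
  rewrite mulrA; apply: ler_wpM2r; first exact: ltW.
  have -> : x * (1 - c * t) = y + t * d ^+ 2 + c * t ^+ 2 by rewrite /x /y cE; ring.
  have h1 : 0 <= t * d ^+ 2 by rewrite mulr_ge0 ?sqr_ge0// ltW.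
  have h2 : 0 <= t ^+ 2 * (c - y / 2) by rewrite mulr_ge0 ?sqr_ge0// /y cE; lra.
  lra.
have mulam : 0 < mu <= lam.
  rewrite mu0 /=; apply: le_trans ratio.
  by rewrite ler_peMl ?(ltW mu0)// lerDl divr_ge0 ?sqr_ge0.
have lam0 : 0 < lam by case/andP: mulam => ? ?; exact: lt_le_trans mu0 _.
have lamexp : expR ((d ^+ 2 - t ^+ 2) / 2) <= lam.
  rewrite /lam ler_pdivlMr//.
  apply: le_trans (_ : expR ((d ^+ 2 - t ^+ 2) / 2) * expR (c * (d - t)) <= _).
    apply: ler_wpM2l; first exact: expR_ge0.
    rewrite /c -mulrA; apply: ler_1DxX; lra.
  rewrite -expRD.
  have -> : x = 1 + (d - t) by rewrite /x; ring.
  apply: le_trans (expR_quad _); last lra.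
  by rewrite ler_expR cE; lra.
have Xn : X ^+ n <= 13 / 10.
  apply: le_trans (_ : expR (1 / 10) <= _).
    apply: le_trans (_ : expR (n%:R * (p * (d - t))) <= _); first by apply: ler_1DxX; lra.
    rewrite ler_expR mulrA -/c cE.
    have : 0 <= (1 - d) * t by rewrite mulr_ge0; lra.
    have : 0 <= d ^+ 2 by exact: sqr_ge0.
    lra.
  apply: le_trans (expR_le_linear _) _; lra.
have B0 : 0 < w ^+ 16 / 12 by rewrite divr_gt0// exprn_gt0.
have mulamX k : mu ^+ k <= lam ^+ k.
  by case/andP: mulam => _ h; apply: lerXn2r => //; rewrite nnegrE ltW.
apply: le_trans (@exists_reach_bound R n p p01 (fun k => 9 / 10 * a < k%:R ^+ 2)
   (fun k => lam ^+ k - mu ^+ k) _ B0 _ _) _.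
- by move=> k; rewrite subr_ge0.
- move=> k hk.
  have kw : 3 / 5 * w ^+ 10 <= k%:R.
    have w100 : 0 <= 3 / 5 * w ^+ 10 by rewrite mulr_ge0 ?divr_ge0 ?exprn_ge0// ltW.
    rewrite -ler_sqr ?nnegrE//; apply: le_trans (ltW hk).
    by rewrite exprMn -exprM -nw; lra.
  (* The relative gain [t ^+ 2 / 2] accumulates over at least [3 / 5 * w ^+ 10] edges to [3 / 10],
     since [t * w ^+ 5 = 1]. *)
  have rhok : 13 / 10 * mu ^+ k <= lam ^+ k.
    apply: le_trans (_ : (1 + t ^+ 2 / 2) ^+ k * mu ^+ k <= _).
      apply: ler_wpM2r; first by rewrite exprn_ge0// ltW.
      apply: le_trans (_ : 1 + k%:R * (t ^+ 2 / 2) <= _).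
        have : 3 / 5 * w ^+ 10 * (t ^+ 2 / 2) <= k%:R * (t ^+ 2 / 2).
          by apply: ler_wpM2r => //; rewrite divr_ge0 ?sqr_ge0.
        have -> : 3 / 5 * w ^+ 10 * (t ^+ 2 / 2) = 3 / 10 * (t * w ^+ 5) ^+ 2 by field.
        by rewrite tw; lra.
      by apply: bernoulli_ineq; rewrite addr_ge0// divr_ge0 ?sqr_ge0.
    rewrite -exprMn; apply: lerXn2r => //; rewrite nnegrE ?(ltW lam0)//.
    by rewrite mulr_ge0 ?(ltW mu0)// addr_ge0// divr_ge0 ?sqr_ge0.
  (* The rate [(d ^+ 2 - t ^+ 2) / 2] per edge gives the exponential assumed to be at least
     [w ^+ 6], up to the factor exp(-3/10). *)
  have lamk : 7 / 10 * w ^+ 6 <= lam ^+ k.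
    apply: le_trans (_ : expR (k%:R * ((d ^+ 2 - t ^+ 2) / 2)) <= _); last first.
      by rewrite expRM_natl; apply: lerXn2r => //; rewrite nnegrE ?expR_ge0// ltW.
    have dt2 : 0 <= (d ^+ 2 - t ^+ 2) / 2.
      have : 0 <= (d - t) * (d + t) by rewrite mulr_ge0; lra.
      lra.
    apply: le_trans (_ : expR (3 / 10 * w ^+ 10 * d ^+ 2 + - (3 / 10)) <= _); last first.
      rewrite ler_expR; apply: le_trans (ler_wpM2r dt2 kw).
      have e : 3 / 10 * w ^+ 10 * t ^+ 2 = 3 / 10 * (t * w ^+ 5) ^+ 2 by ring.
      rewrite tw in e; lra.
    rewrite expRD mulrC; apply: ler_pM => //; [by rewrite exprn_ge0// ltW|by lra|].
    by have := expR_ge1Dx (- (3 / 10) : R); lra.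
  have h1 : 3 / 13 * (7 / 10 * w ^+ 6) <= lam ^+ k - mu ^+ k.
    by move: rhok lamk; move: (lam ^+ k) (mu ^+ k) (w ^+ 6) => L M W; lra.
  have w60 : 0 <= w ^+ 6 by rewrite exprn_ge0// ltW.
  have w100 : 0 <= w ^+ 10 by rewrite exprn_ge0// ltW.
  apply: le_trans (_ : 3 / 5 * w ^+ 10 * (3 / 13 * (7 / 10 * w ^+ 6)) <= _).
    have -> : 3 / 5 * w ^+ 10 * (3 / 13 * (7 / 10 * w ^+ 6)) = 63 / 650 * w ^+ 16 by field.
    have : 0 <= w ^+ 16 by rewrite exprn_ge0// ltW.
    lra.
  by apply: ler_pM => //; lra.
have lamX : lam * X ^+ n = x by rewrite /lam divfK ?gt_eqF.
have muY : mu * Y ^+ n = y by rewrite /mu divfK ?gt_eqF.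
have HX : 1 - p + p * (lam * X ^+ n) <= X.
  by rewrite lamX /x /X; lra.
have HY : Y <= 1 - p + p * (mu * Y ^+ n).
  by rewrite muY /y /Y; lra.
have Y0X : 0 < Y <= X by rewrite Y0.
rewrite ler_pdivrMr//.
apply: le_trans (rooted_exp p01 X1 Y0X mulam HX HY) _; rewrite -aE.
rewrite mul2n -addnn (exprD X) (exprD Y) (mulrA lam) (mulrA mu) lamX muY.
(* At the start of the exploration the two values differ only by order [t]: this is the gain over a
   single exponential. *)
have num : x * X ^+ n - y * Y ^+ n <= 3 * t.
  have h1 : y * ((1 - c * t) * X ^+ n) <= y * Y ^+ n by apply: ler_wpM2l => //; exact: ltW.
  apply: le_trans (_ : X ^+ n * (x - y * (1 - c * t)) <= _); first by lra.
  have e : x - y * (1 - c * t) = t * (1 + y * c) by rewrite /x /y; ring.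
  have yc : y * c <= 11 / 10 * 1.
    by apply: ler_pM; rewrite ?(ltW y0) /c ?mulr_ge0//; [rewrite /y|rewrite -/c cE]; lra.
  have yc0 : 0 <= y * c by rewrite mulr_ge0 ?(ltW y0)// mulr_ge0.
  have h2 : t * (1 + y * c) <= t * (21 / 10) by apply: ler_wpM2l; [exact: ltW|lra].
  have h3 : 0 <= t * (1 + y * c) by rewrite mulr_ge0 ?(ltW t0)//; lra.
  rewrite e; apply: le_trans (_ : 13 / 10 * (t * (21 / 10)) <= _); last lra.
  by apply: ler_pM => //; exact: ltW.
have a0 : 0 <= a by rewrite aE; exact: expected_edges_ge0.
apply: le_trans (ler_wpM2l a0 num) _.
have h4 : a * (3 * t) <= w ^+ 20 / 2 * (3 * t).
  by apply: ler_wpM2r; [rewrite mulr_ge0// ltW|rewrite -nw].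
apply: le_trans h4 _.
have -> : w ^+ 20 / 2 * (3 * t) = 3 / 2 * w ^+ 15 * (t * w ^+ 5) by field.
have -> : 18 / w * (w ^+ 16 / 12) = 3 / 2 * w ^+ 15 by field; rewrite gt_eqF.
by rewrite tw mulr1.
Qed.

End Subcritical.

(** * The expected number of edges *)

Section Counting.
Variable R : realType.

Lemma card_pairs n : #|pairs 'I_n|%:R = n%:R * (n%:R - 1) / 2 :> R.
Proof.
rewrite /pairs card_draws card_ord.
have := bin_ffact n 2; rewrite ffactnS ffactn1 => /(congr1 (fun k => k%:R : R)).
rewrite !natrM; case: n => [|n]; first by rewrite !mul0r bin_small.
have -> : n.+1%:R - 1 = n%:R :> R by rewrite -addn1 natrD addrK.
by rewrite /= !mulr1 => <-; rewrite mulfK ?pnatr_eq0.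
Qed.

Variables (n : nat) (p a : R).
Hypothesis p0 : 0 < p.
Hypothesis n2 : (2 <= n)%N.
Hypothesis aE : a = #|pairs 'I_n|%:R * p.

Let n2R : 2 <= n%:R :> R. Proof. by rewrite ler_nat. Qed.

Lemma expected_edges_ge : n%:R ^+ 2 * p <= 4 * a.
Proof.
rewrite aE card_pairs; have : 0 <= n%:R * p * (n%:R - 2).
  by rewrite !mulr_ge0// ?subr_ge0// ltW.
lra.
Qed.

Lemma expected_edges_le : 2 * a <= n%:R ^+ 2 * p.
Proof.
rewrite aE card_pairs; have : 0 <= n%:R * p by rewrite mulr_ge0// ltW.
lra.
Qed.

Lemma expected_edges_gt0 : 0 < a.
Proof.
rewrite aE card_pairs !mulr_gt0// ?invr_gt0//; have := n2R; lra.
Qed.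

End Counting.

(** * From component sizes to the score *)

Section Deterministic.
Variables (R : realType) (n : nat).
Implicit Types (G : simple_graph 'I_n).

Lemma matching_score G : ~~ [exists f in edges G, (1 < #|reach f (edges G)|)%N] ->
  (nb_edges G == 0%N) (+) ((modularity R G == mod_score R G (components G))
     && (mod_score R G (components G) == 1 - 1 / (nb_edges G)%:R)).
Proof.
move=> /exists_inPn single.
have N1 f : f \in edges G -> #|reach f (edges G)| = 1%N.
  move=> fE; have := single f fE; rewrite -leqNgt => h; apply/eqP.
  by rewrite eqn_leq h card_reach_root ?edges_pairs.
(* Without edges the score is 0 while [1 - 1 / 0] is 1, by the convention [0^-1 = 0]; so the second
   alternative fails. *)
have [m0|m0] := eqVneq (nb_edges G) 0%N.
  rewrite /= andbC [_ == 1 - _](_ : _ = false)//.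
  by rewrite /mod_score m0 expr0n /= mulr0 invr0 !mul0r mulr0 !subr0 eq_sym oner_eq0.
have mp : (0 < nb_edges G)%N by rewrite lt0n.
rewrite /= modularity_components ?eqxx//=; last by move=> e eE; rewrite N1.
rewrite mod_score_components//; apply/eqP; congr (_ - _).
rewrite /nb_linked (eq_bigr (fun _ => 1)) => [|f fE]; last by rewrite N1.
have mR : (nb_edges G)%:R != 0 :> R by rewrite pnatr_eq0.
by rewrite sumr_const -/(nb_edges G); field.
Qed.

(** [D] stands for n^2 p and [M] for the mean of X, of order [a / d]; hence X/m^2 is of order
    [1 / (D * d)]. *)
Lemma subcritical_score G (a d M D : R) : 0 < a -> 0 < d ->
  `|#|edges G|%:R - a| < a / 10 -> `|nb_linked R (edges G) - M| < M / 2 ->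
  a <= 2 * d * M -> d * M <= 14 * a ->
  (forall f, f \in edges G -> #|reach f (edges G)|%:R ^+ 2 <= 9 / 10 * a) ->
  2 * a <= D -> D <= 4 * a ->
  [&& modularity R G == mod_score R G (components G),
      (1 / 3) / (D * d) <= 1 - mod_score R G (components G) &
      1 - mod_score R G (components G) <= 104 / (D * d)].
Proof.
move=> a0 d0; rewrite !ltr_norml => /andP[m1 m2] /andP[X1 X2] lo hi small D1 D2.
rewrite -/(nb_edges G) in m1 m2.
have mp : (0 < nb_edges G)%N by rewrite -(ltr_nat R); lra.
have mR : 0 < (nb_edges G)%:R :> R by rewrite ltr0n.
have D0 : 0 < D by lra.
rewrite modularity_components//; last first.
  move=> e /small h; rewrite -(ler_nat R) natrX -/(nb_edges G); lra.
rewrite eqxx mod_score_components//= subKr.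
set m := (nb_edges G)%:R in m1 m2 mR *; set X := nb_linked R (edges G) in X1 X2 *.
have dX1 : a / 4 <= d * X.
  have : d * (M / 2) <= d * X by apply: ler_wpM2l; lra.
  lra.
have dX2 : d * X <= 21 * a.
  have : d * X <= d * (3 / 2 * M) by apply: ler_wpM2l; lra.
  lra.
have ms1 : m ^+ 2 <= 121 / 100 * a ^+ 2.
  have : m ^+ 2 <= (11 / 10 * a) ^+ 2 by rewrite ler_sqr ?nnegrE; lra.
  lra.
have ms2 : 81 / 100 * a ^+ 2 <= m ^+ 2.
  have : (9 / 10 * a) ^+ 2 <= m ^+ 2 by rewrite ler_sqr ?nnegrE; lra.
  lra.
have m20 : 0 < m ^+ 2 by rewrite exprn_gt0.
have Dd0 : 0 < D * d by rewrite mulr_gt0.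
have aa0 : 0 <= a ^+ 2 by exact: sqr_ge0.
(* The constants come from [a ^+ 2 / 2 <= D * (d * X) <= 84 * a ^+ 2] and the bounds on [m ^+ 2]:
   1/3 of 121/100 is below 1/2, and 84 is below 104 times 81/100. *)
apply/andP; split; rewrite ler_pdivrMr//.
  rewrite mulrAC ler_pdivlMr//.
  have : 2 * a * (a / 4) <= D * (d * X) by apply: ler_pM => //; lra.
  lra.
rewrite mulrAC ler_pdivlMr//.
have : D * (d * X) <= 4 * a * (21 * a) by apply: ler_pM => //; lra.
lra.
Qed.

(** A small edge is linked to fewer than [K] edges, a large one only to large edges, of which there
    are at most [B]. *)
Lemma nb_linked_small_large K G (B : R) :
  #|edges G|%:R - #|small_edges K (edges G)|%:R <= B ->
  nb_linked R (edges G) <= K%:R * #|edges G|%:R + B ^+ 2.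
Proof.
set E := edges G; have EP : E \subset pairs 'I_n := edges_pairs G.
set S := small_edges K E => hB.
have SE : (S \subset E)%SET by apply/fintype.subsetP => f; rewrite inE => /andP[].
have cL : #|(E :\: S)%SET|%:R <= B.
  apply: le_trans hB; rewrite -(cardsID S E) (finset.setIidPr SE) natrD; lra.
have B0 : 0 <= B by apply: le_trans cL.
rewrite /nb_linked (big_setID S) /= (finset.setIidPr SE); apply: lerD.
  apply: le_trans (_ : \sum_(f in S) K%:R <= _).
    by apply: ler_sum => f; rewrite inE => /andP[_ fK]; rewrite ler_nat ltnW.
  by rewrite sumr_const -[leLHS]mulr_natr ler_wpM2l// ler_nat subset_leq_card.
apply: le_trans (_ : \sum_(f in (E :\: S)%SET) B <= _); last first.
  by rewrite sumr_const -[leLHS]mulr_natr expr2 ler_wpM2l.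
apply: ler_sum => f; rewrite inE => /andP[fS fE]; apply: le_trans cL.
rewrite ler_nat; apply/subset_leq_card/fintype.subsetP => g gf.
have gE : g \in E by move: gf; rewrite inE => /andP[].
move: fS; rewrite !inE fE gE !andbT /= (reach_eq EP fE gf).
by [].
Qed.

End Deterministic.

(** * The subcritical window *)

Section SubcriticalProbability.
Variable R : realType.
Implicit Types (n : nat) (p : R).

Definition subcritical_bad n p (E : {set {set 'I_n}}) :=
  let a := #|pairs 'I_n|%:R * p in
  let M := bexp p (pairs 'I_n) (@nb_linked R 'I_n) in
  [|| a / 10 <= `|#|E|%:R - a|, M / 2 <= `|nb_linked R E - M|
    | [exists f in E, 9 / 10 * a < #|reach f E|%:R ^+ 2]].

Lemma ler_pdiv_denom (C x B : R) : 0 <= C -> 0 < B -> B <= x -> C / x <= C / B.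
Proof.
by move=> C0 B0 Bx; rewrite ler_wpM2l// lef_pV2// posrE (lt_le_trans B0).
Qed.

(** [w] is n^(1/20) and [t] is n^(-1/4). The square root of ln n is at least 2, so the window keeps
    [1 - n%:R * p] above [2 * t]. *)
Lemma window_facts n p (B : R) : 0 < p <= 1 -> 22 <= B -> B <= ln n%:R ->
  n%:R * p <= 1 - (ln n%:R) `^ (1 / 2) * n%:R `^ (- (1 / 4)) ->
  exists w t : R, [/\ B / 20 <= w, n%:R = w ^+ 20, t * w ^+ 5 = 1,
    2 * t <= 1 - n%:R * p & ln n%:R * t ^+ 2 <= (1 - n%:R * p) ^+ 2] /\
    (forall x : R, 3 / 10 * ln n%:R <= x -> w ^+ 6 <= expR x).
Proof.
move=> /andP[p0 p1] B22; set l := ln n%:R => Bl hyp.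
have n0 : 0 < n%:R :> R.
  (* At 0 the logarithm has the default value 0, which [22 <= B] excludes. *)
  rewrite ltr0n lt0n; apply/eqP => n0; move: Bl; rewrite /l n0 ln0//; lra.
have nl : n%:R = expR l :> R by rewrite lnK// posrE.
set r := l `^ (1 / 2) in hyp; set t := n%:R `^ (- (1 / 4)) in hyp.
have r2 : r ^+ 2 = l by rewrite /r div1r powR12_sqrt ?sqr_sqrtr//; lra.
have r0 : 0 <= r by exact: powR_ge0.
have rge2 : 2 <= r.
  rewrite -ler_sqr ?nnegrE// r2; lra.
have tE : t = expR (- (l / 4)).
  by rewrite /t /powR gt_eqF//; congr expR; rewrite -/l; field.
have t0 : 0 < t by rewrite tE expR_gt0.
exists (expR (l / 20)), t; split; last first.
  by move=> x hx; rewrite -expRM_natl ler_expR; lra.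
split.
- by apply: le_trans (expR_ge1Dx _); lra.
- by rewrite nl -expRM_natl; congr expR; field.
- by rewrite tE -expRM_natl -expRD -[RHS](expR0 R); congr expR; field.
- have : 2 * t <= r * t by rewrite ler_wpM2r// ltW.
  lra.
- have rt0 : 0 <= r * t by rewrite mulr_ge0// ltW.
  by rewrite -r2 -exprMn ler_sqr ?nnegrE//; lra.
Qed.

(** For d = 1 - np <= 1 it suffices to bound n d^4; from d^2 >= t^2 ln n and n t^4 = 1 this is at
    least (ln n)^2. *)
Lemma window_cube n p (B : R) : 0 < p <= 1 -> 22 <= B -> B <= ln n%:R ->
  n%:R * p <= 1 - (ln n%:R) `^ (1 / 2) * n%:R `^ (- (1 / 4)) ->
  B ^+ 2 <= n%:R * (1 - n%:R * p) ^+ 3.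
Proof.
move=> pp B22 Bl hyp; have /andP[p0 p1] := pp.
have [w [t [[wB nw tw td dt] _]]] := window_facts pp B22 Bl hyp.
have w0 : 0 < w by apply: lt_le_trans wB; lra.
have t0 : 0 < t by rewrite -(pmulr_lgt0 _ (exprn_gt0 5 w0)) tw.
set l := ln n%:R in Bl dt; set d := 1 - n%:R * p in td dt *.
have d0 : 0 < d by lra.
have d1 : d <= 1 by rewrite /d; have := mulr_ge0 (ler0n R n) (ltW p0); lra.
have l0 : 0 <= l by lra.
apply: le_trans (_ : l ^+ 2 <= _); first by rewrite ler_sqr ?nnegrE//; lra.
apply: le_trans (_ : n%:R * d ^+ 4 <= _); last first.
  by apply: ler_wpM2l => //; rewrite (exprS d 3) ler_piMl// exprn_ge0// ltW.
have -> : l ^+ 2 = w ^+ 20 * (l * t ^+ 2) ^+ 2.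
  have -> : w ^+ 20 * (l * t ^+ 2) ^+ 2 = l ^+ 2 * (t * w ^+ 5) ^+ 4 by ring.
  by rewrite tw expr1n mulr1.
rewrite nw; apply: ler_wpM2l; first by rewrite exprn_ge0// ltW.
have lt0 : 0 <= l * t ^+ 2 by apply: mulr_ge0 => //; exact: sqr_ge0.
by rewrite (exprM d 2 2) ler_sqr ?nnegrE ?sqr_ge0.
Qed.

(** Multiplied by n, the left side is at most 448, while [window_cube] gives at least 22^2 = 484 on
    the right. *)
Lemma window_density n p (B : R) : 0 < p <= 1 -> 22 <= B -> B <= ln n%:R ->
  n%:R * p <= 1 - (ln n%:R) `^ (1 / 2) * n%:R `^ (- (1 / 4)) ->
  8 * (56 * p) <= (1 - n%:R * p) ^+ 3.
Proof.
move=> pp B22 Bl hyp; have nd := window_cube pp B22 Bl hyp.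
have [w [t [[wB nw tw td _] _]]] := window_facts pp B22 Bl hyp.
have w0 : 0 < w by apply: lt_le_trans wB; lra.
have t0 : 0 < t by rewrite -(pmulr_lgt0 _ (exprn_gt0 5 w0)) tw.
have n0 : 0 < n%:R :> R by rewrite nw exprn_gt0.
rewrite -(ler_pM2l n0); apply: le_trans nd.
have : 22 * 22 <= B ^+ 2 by rewrite expr2; apply: ler_pM => //; lra.
lra.
Qed.

Lemma subcritical_bad_bound : exists2 C : R, 0 <= C & forall n p (B : R),
  0 < p <= 1 -> 22 <= B -> B <= n%:R ^+ 2 * p -> B <= ln n%:R ->
  n%:R * p <= 1 - (ln n%:R) `^ (1 / 2) * n%:R `^ (- (1 / 4)) ->
  bexp p (pairs 'I_n) (fun E => (subcritical_bad p E)%:R) <= C / B.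
Proof.
pose C1 : R := 400; pose C2 : R := 32 * (16 * 336); pose C3 : R := 4 * (2 * 336 * 10 ^+ 5).
pose C4 : R := 20 * 18.
have C1p : 0 <= C1 by exact: ler0n.
have C2p : 0 <= C2 by rewrite /C2 !mulr_ge0.
have C3p : 0 <= C3 by rewrite /C3 !mulr_ge0// exprn_ge0.
have C4p : 0 <= C4 by rewrite /C4 mulr_ge0.
exists (C1 + (C2 + (C3 + C4))); first by rewrite !addr_ge0.
move=> n p B pp B22 Bn Bl hyp; have /andP[p0 p1] := pp.
have p01 : 0 <= p <= 1 by rewrite ltW.
have B0 : 0 < B by lra.
have [w [t [[wB nw tw td dt] ew]]] := window_facts pp B22 Bl hyp.
have w0 : 0 < w by apply: lt_le_trans wB; rewrite divr_gt0.
have n22 : 22 <= n%:R :> R.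
  apply: le_trans (le_trans B22 Bl) _; apply/ltW/ln_sublinear.
  by rewrite nw exprn_gt0.
have n2 : (2 <= n)%N by rewrite -(ler_nat R); lra.
set a := #|pairs 'I_n|%:R * p.
have a0 : 0 < a := expected_edges_gt0 p0 n2 erefl.
have aB : B <= 4 * a := le_trans Bn (expected_edges_ge p0 n2 erefl).
have ale : 2 * a <= n%:R ^+ 2 * p := expected_edges_le p0 erefl.
set l := ln n%:R in Bl ew dt.
pose d := 1 - n%:R * p; have dE : d = 1 - n%:R * p by [].
rewrite -!dE in td dt.
have t0 : 0 < t by rewrite -(pmulr_lgt0 _ (exprn_gt0 5 w0)) tw.
have d0 : 0 < d by lra.
have np0 : 0 <= n%:R * p by rewrite mulr_ge0// ltW.
have d1 : d <= 1 by lra.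
have n0 : 0 < n%:R :> R by lra.
have l0 : 0 <= l by lra.
have nd3 : B ^+ 2 <= n%:R * d ^+ 3 by exact: window_cube.
have pd3 : 8 * (56 * p) <= d ^+ 3 by exact: window_density pp B22 Bl hyp.
(* For np >= 1/2, [a] is at least n/8 and [nd3] applies; otherwise [d] exceeds 1/2 and [a] is at
   least [B / 4]. *)
have ad3 : B / 32 <= a * d ^+ 3.
  have [c2|c2] := leP (1 / 2) (n%:R * p).
    have h1 : n%:R / 8 <= a.
      have : n%:R * (1 / 2) <= n%:R * (n%:R * p) by apply: ler_wpM2l => //; exact: ltW.
      have := expected_edges_ge p0 n2 (erefl a); rewrite -/a expr2; lra.
    apply: le_trans (_ : n%:R / 8 * d ^+ 3 <= _).
      have : B * 22 <= B ^+ 2 by rewrite expr2; apply: ler_wpM2l => //; exact: ltW.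
      lra.
    by apply: ler_wpM2r => //; rewrite exprn_ge0// ltW.
  have h : (1 / 2) ^+ 3 <= d ^+ 3 by apply: lerXn2r; rewrite ?nnegrE //; lra.
  have := ler_wpM2l (ltW a0) h; lra.
have b1 : bexp p (pairs 'I_n) (fun E => (a / 10 <= `|#|E|%:R - a|)%R%:R) <= C1 / B.
  have a10 : 0 < a / 10 by rewrite divr_gt0.
  apply: le_trans (concentration_card n p01 a10) _.
  have -> : #|pairs 'I_n|%:R * p / (a / 10) ^+ 2 = 100 / a.
    by rewrite -/a; field; rewrite gt_eqF.
  have -> : 100 / a = 400 / (4 * a) by field; rewrite gt_eqF.
  exact: ler_pdiv_denom.
set M := bexp p (pairs 'I_n) (@nb_linked R 'I_n).
have b2 : bexp p (pairs 'I_n) (fun E => (M / 2 <= `|nb_linked R E - M|)%R%:R) <= C2 / B.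
  have h := @concentration_nb_linked R n p d p01 d0 dE a erefl a0 pd3.
  apply: (le_trans h).
  have -> : 16 * 336 / (a * d ^+ 3) = C2 / (32 * (a * d ^+ 3)).
    by rewrite /C2; field; rewrite !gt_eqF.
  by apply: ler_pdiv_denom => //; lra.
have b3 : bexp p (pairs 'I_n)
    (fun E => [exists f in E, 9 / 10 * a < #|reach f E|%:R ^+ 2]%:R) <= (C3 + C4) / B.
  (* Away from criticality the third moment is enough; close to it the difference of exponentials is
     needed. *)
  rewrite [leRHS]mulrDl; have [far|near] := leP (1 / 10) d.
    have h := @component_bound_far R n p d p01 d0 dE a erefl a0 far; apply: (le_trans h).
    rewrite -[leLHS]addr0; apply: lerD; last by rewrite divr_ge0// ltW.
    have -> : 2 * 336 * 10 ^+ 5 / a = C3 / (4 * a) by rewrite /C3; field; rewrite gt_eqF.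
    exact: ler_pdiv_denom.
  apply: le_trans (_ : 18 / w <= _); last first.
    rewrite -[leLHS]add0r; apply: lerD; first by rewrite divr_ge0// ltW.
    have -> : 18 / w = C4 / (20 * w) by rewrite /C4; field; rewrite gt_eqF.
    by apply: ler_pdiv_denom => //; lra.
  have h := @component_bound_near R n p d p01 dE a erefl w t w0 nw tw td (ltW near); apply: h.
  - apply: ew; have := ler_wpM2l (exprn_ge0 10 (ltW w0)) dt.
    have -> : w ^+ 10 * (l * t ^+ 2) = l * (t * w ^+ 5) ^+ 2 by ring.
    rewrite tw; lra.
  - rewrite /a card_pairs.
    rewrite /d in near.
    have : 0 <= (n%:R - 1) * (n%:R * p - 9 / 10) by rewrite mulr_ge0; lra.
    lra.
  - have : n%:R * (n%:R * p) <= n%:R * 1 by apply: ler_wpM2l; lra.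
    by move: ale; rewrite expr2; lra.
have -> : (C1 + (C2 + (C3 + C4))) / B = C1 / B + (C2 / B + (C3 + C4) / B).
  by rewrite !mulrDl.
apply: le_trans (bexp_union p01 _ _ _) _; apply: lerD => //.
by apply: le_trans (bexp_union p01 _ _ _) _; apply: lerD.
Qed.

End SubcriticalProbability.

(** * The supercritical window *)

Section Supercritical.
Variable R : realType.
Implicit Types (n K : nat) (p eps : R).

(* 1 - rho is an upper bound for the extinction probability of the branching
   process dominating the exploration, so a proportion at most 1 - (1 - rho)^2
   of the edges lies in large components. *)
Lemma large_edges_mean n K p (rho mu : R) : 0 <= p <= 1 -> 0 <= rho < 1 -> 0 < mu <= 1 ->
  1 - rho <= mu * (1 - rho * p) ^+ n ->
  (1 - mu ^+ K) * (#|pairs 'I_n|%:R * p -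
     bexp p (pairs 'I_n) (fun E => #|small_edges K E|%:R)) <=
  #|pairs 'I_n|%:R * p * (1 - (1 - rho) ^+ 2).
Proof.
move=> p01 /andP[r0 r1] /andP[mu0 mu1] hyp; have /andP[p0 p1] := p01.
have rp : rho * p <= rho by rewrite ler_piMr.
have rp0 : 0 <= rho * p by exact: mulr_ge0.
(* [1 - rho * p] is the chance that a queried pair is absent or starts a branch that dies out, if a
   branch dies with probability [1 - rho]. *)
have Y0 : 0 < 1 - rho * p <= 1 by apply/andP; split; lra.
have HX : 1 - p + p * (1 * 1 ^+ n) <= 1 by rewrite expr1n !mulr1 subrK.
have mu01 : 0 < mu <= 1 by rewrite mu0.
have HY : 1 - rho * p <= 1 - p + p * (mu * (1 - rho * p) ^+ n).
  have := ler_wpM2l p0 hyp; lra.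
have := rooted_exp p01 (lexx 1) Y0 mu01 HX HY.
rewrite expr1n mulr1 => h.
apply: le_trans (le_trans h _); last first.
  apply: ler_wpM2l; first by rewrite mulr_ge0.
  rewrite lerD2l lerN2 mul2n -addnn exprD mulrA expr2.
  have Yn : 1 - rho <= (1 - rho * p) ^+ n.
    apply: le_trans hyp _; rewrite ler_piMl// exprn_ge0//; lra.
  by apply: ler_pM => //; lra.
have -> : #|pairs 'I_n|%:R * p - bexp p (pairs 'I_n) (fun E => #|small_edges K E|%:R) =
    bexp p (pairs 'I_n) (fun E => #|E|%:R + -1 * #|small_edges K E|%:R).
  by rewrite bexpD bexpZ bexp_card mulN1r.
rewrite -bexpZ; apply: bexp_le => // E EP; rewrite mulN1r.
have SE : (small_edges K E \subset E)%SET by apply/fintype.subsetP => f; rewrite inE => /andP[].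
(* Small edges have nonnegative weight and are dropped; an edge in a component with at least [K]
   edges has weight at least [1 - mu ^+ K]. *)
rewrite (big_setID (small_edges K E)) /= ler_wpDl//.
  by apply: sumr_ge0 => f _; rewrite expr1n subr_ge0 exprn_ile1// ltW.
rewrite -(cardsID (small_edges K E) E) (finset.setIidPr SE) natrD addrAC subrr add0r mulr_natr -sumr_const.
apply: ler_sum => f; rewrite !inE => /andP[+ fE]; rewrite fE /= -leqNgt => Kf.
by rewrite expr1n lerD2l lerN2 ler_wiXn2l// ltW.
Qed.

(** Compared in the exponent: second-order bounds on both sides reduce the claim to [h3]. *)
Lemma extinction_bound n p eps : 0 < eps <= 1 / 4 -> 0 < p -> (2 <= n)%N ->
  n%:R * p <= 1 + eps -> 2 <= eps ^+ 3 * n%:R ->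
  let rho := 2 * eps + eps ^+ 2 in
  1 - rho <= expR (- (eps ^+ 3 / 2)) * (1 - rho * p) ^+ n.
Proof.
move=> /andP[e0 e1] p0 n2 np en; set rho := 2 * eps + eps ^+ 2.
have n0 : 2 <= n%:R :> R by rewrite ler_nat.
have ee : eps ^+ 2 <= eps * (1 / 4) by rewrite expr2 ler_wpM2l// ltW.
have ee0 : 0 <= eps ^+ 2 by exact: sqr_ge0.
have r0 : 0 <= rho by rewrite /rho; lra.
have r1 : rho <= 9 / 16 by rewrite /rho; lra.
have p58 : p <= 5 / 8.
  have : 2 * p <= n%:R * p by rewrite ler_wpM2r// ltW.
  lra.
have rp : 0 <= rho * p <= 1 / 2.
  rewrite mulr_ge0 ?(ltW p0)//=.
  have : rho * p <= 9 / 16 * (5 / 8) by apply: ler_pM => //; exact: ltW.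
  lra.
apply: le_trans (expR_quadN r0) _.
apply: le_trans (_ : expR (- (eps ^+ 3 / 2)) *
   expR (- (n%:R * (rho * p + 2 * (rho * p) ^+ 2))) <= _); last first.
  by apply: ler_wpM2l; [exact: expR_ge0|exact: expR_le_1BxX].
rewrite -expRD ler_expR.
have h1 : rho * (n%:R * p) <= rho * (1 + eps) by apply: ler_wpM2l.
(* The quadratic error is of order 1/n, which the lower bound on [n] absorbs. *)
have h2 : n%:R * (2 * (rho * p) ^+ 2) <= eps ^+ 3 / 2.
  rewrite -(ler_pM2r (_ : 0 < n%:R :> R)); last by lra.
  apply: le_trans (_ : 1 <= _); last by lra.
  have -> : n%:R * (2 * (rho * p) ^+ 2) * n%:R = 2 * (rho ^+ 2 * (n%:R * p) ^+ 2) by ring.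
  have q1 : rho ^+ 2 <= (9 / 16) ^+ 2 by rewrite ler_sqr ?nnegrE//; lra.
  have q2 : (n%:R * p) ^+ 2 <= (5 / 4) ^+ 2.
    by rewrite ler_sqr ?nnegrE ?mulr_ge0 ?(ltW p0)//; lra.
  have : rho ^+ 2 * (n%:R * p) ^+ 2 <= (9 / 16) ^+ 2 * (5 / 4) ^+ 2.
    by apply: ler_pM => //; exact: sqr_ge0.
  lra.
(* This is the reason for the choice of [rho]: the right side exceeds the left by exactly
   [eps ^+ 4 / 2]. *)
have h3 : rho * eps + eps ^+ 3 <= rho ^+ 2 / 2.
  have -> : rho ^+ 2 / 2 = rho * eps + eps ^+ 3 + eps ^+ 4 / 2 by rewrite /rho; field.
  have : 0 <= eps ^+ 4 by rewrite exprn_ge0// ltW.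
  lra.
lra.
Qed.

(** X is at most [K * m] plus the square of the number of large edges. That number is at most
    [a * (4 * eps - 6 / 5 * eps ^+ 2)], which leaves room of order [eps ^+ 3 * a ^+ 2] below
    [(4 * eps * m) ^+ 2] for the term [K * m]. *)
Lemma supercritical_score n K (G : simple_graph 'I_n) (a eps s muK : R) :
  0 < eps <= 1 / 4 -> 0 < a -> K%:R <= eps ^+ 3 * a -> muK <= eps / 8 ->
  (1 - muK) * (a - s) <= a * (1 - (1 - (2 * eps + eps ^+ 2)) ^+ 2) ->
  `|#|edges G|%:R - a| < eps ^+ 2 / 10 * a ->
  `|#|small_edges K (edges G)|%:R - s| < eps ^+ 2 / 10 * a ->
  1 - (4 * eps) ^+ 2 < mod_score R G (components G).
Proof.
move=> /andP[e0 e1] a0 Ka muKe mean; rewrite !ltr_norml => /andP[m1 m2] /andP[s1 s2].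
have ee : eps ^+ 2 <= eps * (1 / 4) by rewrite expr2 ler_wpM2l// ltW.
have ee0 : 0 < eps ^+ 2 by exact: exprn_gt0.
have eee : eps ^+ 3 <= eps ^+ 2 * (1 / 4) by rewrite exprSr ler_wpM2l// ltW.
have eee0 : 0 < eps ^+ 3 by exact: exprn_gt0.
have aee : a * eps ^+ 2 <= a * (1 / 16) by apply: ler_wpM2l; [exact: ltW|lra].
have aee0 : 0 < a * eps ^+ 2 by exact: mulr_gt0.
rewrite -/(nb_edges G) in m1 m2.
have mp : (0 < nb_edges G)%N by rewrite -(ltr_nat R); lra.
rewrite mod_score_components//.
have L : a - s <= a * (4 * eps - 7 / 5 * eps ^+ 2).
  (* The left side has [- 2 * eps ^+ 2] to spare: the factor [1 - eps / 8] uses 1/2 of this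
     coefficient and 7/5 is kept. *)
  have Q : 1 - (1 - (2 * eps + eps ^+ 2)) ^+ 2 <=
      (1 - eps / 8) * (4 * eps - 7 / 5 * eps ^+ 2).
    have e40 : 0 <= eps ^+ 4 by rewrite exprn_ge0// ltW.
    have -> : 1 - (1 - (2 * eps + eps ^+ 2)) ^+ 2 =
      4 * eps - 2 * eps ^+ 2 - 4 * eps ^+ 3 - eps ^+ 4 by ring.
    have -> : (1 - eps / 8) * (4 * eps - 7 / 5 * eps ^+ 2) =
      4 * eps - 19 / 10 * eps ^+ 2 + 7 / 40 * eps ^+ 3 by field.
    lra.
  have e2 : 0 <= 4 * eps - 7 / 5 * eps ^+ 2 by lra.
  have [L0|/ltW L0] := leP (a - s) 0.
    by apply: le_trans L0 _; rewrite mulr_ge0// ltW.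
  have k0 : 0 < 1 - eps / 8 by lra.
  rewrite -(ler_pM2l k0); apply: le_trans (_ : (1 - muK) * (a - s) <= _).
    by apply: ler_wpM2r => //; lra.
  apply: le_trans mean _; rewrite mulrCA; apply: ler_wpM2l => //; exact: ltW.
set m := (nb_edges G)%:R in m1 m2 *.
have B : m - #|small_edges K (edges G)|%:R <= a * (4 * eps - 6 / 5 * eps ^+ 2) by lra.
have := nb_linked_small_large B; rewrite -/(nb_edges G) -/m.
set X := nb_linked R (edges G) => hX.
have m0 : 0 < m by lra.
rewrite ltrD2l ltrN2 ltr_pdivrMr ?exprn_gt0//.
apply: le_lt_trans hX _; rewrite -exprMn.
have m4 : a * (4 * eps - 1 / 10 * eps ^+ 2) <= 4 * eps * m.
  have : 4 * eps * (a - eps ^+ 2 / 10 * a) <= 4 * eps * m by apply: ler_wpM2l; lra.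
  have : a * eps ^+ 3 <= a * (eps ^+ 2 * (1 / 4)) by apply: ler_wpM2l => //; exact: ltW.
  lra.
have sq : (a * (4 * eps - 1 / 10 * eps ^+ 2)) ^+ 2 <= (4 * eps * m) ^+ 2.
  have c0 : 0 <= a * (4 * eps - 1 / 10 * eps ^+ 2) by rewrite mulr_ge0 ?(ltW a0)//; lra.
  by rewrite ler_sqr ?nnegrE// (le_trans c0).
apply: lt_le_trans sq.
have Km : K%:R * m <= eps ^+ 3 * a * (2 * a) by apply: ler_pM => //; lra.
have aa0 : 0 < a ^+ 2 by exact: exprn_gt0.
have fin : 0 < a ^+ 2 * (eps ^+ 3 * (34 / 5 - 143 / 100 * eps)).
  by rewrite !mulr_gt0//; lra.
have -> : (a * (4 * eps - 1 / 10 * eps ^+ 2)) ^+ 2 =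
  (a * (4 * eps - 6 / 5 * eps ^+ 2)) ^+ 2 + eps ^+ 3 * a * (2 * a) +
  a ^+ 2 * (eps ^+ 3 * (34 / 5 - 143 / 100 * eps)) by field.
lra.
Qed.

End Supercritical.

(** * Assembly of the three regimes *)

Lemma near_ler_ln (R : realType) (A : R) : \forall n \near \oo, A <= ln n%:R.
Proof.
near=> n; have h : expR A <= n%:R by near: n; exact: nbhs_infty_ger.
rewrite -(expRK A) ler_ln// posrE ?expR_gt0//.
by apply: lt_le_trans h; exact: expR_gt0.
Unshelve. all: by end_near. Qed.

Unset Implicit Arguments.

Theorem theorem1p2 (R : realType) (p : nat -> R)
    (p01 : forall n, (0 < n)%N -> 0 < p n <= 1) :
  [/\ (* (i) *)
      (n%:R `^ (3 / 2) * p n @[n --> \oo] --> (0 : R)) ->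
      whp p (fun n G =>
        (nb_edges G == 0%N)
        (+) ((modularity R G == mod_score R G (components G))
             && (mod_score R G (components G) == 1 - 1 / (nb_edges G)%:R))),
      (* (ii) *)
      (n%:R ^+ 2 * p n @[n --> \oo] --> +oo) ->
      (\forall n \near \oo,
         n%:R * p n <= 1 - (ln n%:R) `^ (1 / 2) * n%:R `^ (- (1 / 4))) ->
      exists alpha beta : R,
        0 < alpha < beta /\
        whp p (fun n G =>
          [&& modularity R G == mod_score R G (components G),
              alpha / (n%:R ^+ 2 * p n * (1 - n%:R * p n))
                <= 1 - mod_score R G (components G) &
              1 - mod_score R G (components G)
                <= beta / (n%:R ^+ 2 * p n * (1 - n%:R * p n))])
    & (* (iii) *)
      forall eps : R, 0 < eps <= 1 / 4 ->
      (\forall n \near \oo, 1 <= n%:R * p n <= 1 + eps) ->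
      whp p (fun n G =>
        (mod_score R G (components G) <= modularity R G)
        && (1 - (4 * eps) ^+ 2 < mod_score R G (components G)))].
Proof.
split.
- move=> /cvgrPdist_le lim.
  apply: (@whp_of_bexp R p _ (fun n E => [exists f in E, (1 < #|reach f E|)%N])) => // e e0.
  (* The first bound ensures np <= 1/2 for [matching_bound]; both together make the final square at
     most [e / 4]. *)
  pose h := Num.min (1 / 2) (e / 2).
  have h0 : 0 < h by rewrite lt_min !divr_gt0.
  near=> n; split; first exact: matching_score.
  have n2 : (2 <= n)%N by near: n; exact: nbhs_infty_ge.
  have n2R : 2 <= n%:R :> R by rewrite ler_nat.
  have /andP[p0 p1] := p01 n (ltnW n2).
  have pp : 0 <= p n <= 1 by rewrite ltW.
  have : `|0 - n%:R `^ (3 / 2) * p n| <= h by near: n; exact: lim.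
  rewrite sub0r normrN ger0_norm; last by rewrite mulr_ge0 ?powR_ge0// ltW.
  set q := n%:R `^ (3 / 2); rewrite le_min => /andP[q1 q2].
  have q0 : 0 <= q by exact: powR_ge0.
  have nq : n%:R <= q by apply: le1r_powR; lra.
  have qq : q ^+ 2 = n%:R ^+ 3.
    rewrite -!powR_mulrn// /q -powRrM; congr (_ `^ _); by field.
  have npq : n%:R * p n <= q * p n by rewrite ler_wpM2r// ltW.
  have np2 : n%:R * p n <= 1 / 2 by lra.
  apply: (le_trans (@matching_bound R n (p n) pp np2)).
  (* The bound 4npa is at most 2 n^3 p^2, and n^3 is the square of [q]. *)
  apply: le_trans (_ : 2 * (q * p n) ^+ 2 <= _).
    have -> : (q * p n) ^+ 2 = n%:R * p n * (n%:R ^+ 2 * p n) by rewrite exprMn qq; ring.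
    have np0 : 0 <= n%:R * p n by rewrite mulr_ge0// ltW.
    have := ler_wpM2l np0 (expected_edges_le p0 (erefl (#|pairs 'I_n|%:R * p n))).
    lra.
  have : (q * p n) ^+ 2 <= 1 / 2 * (e / 2).
    by rewrite expr2; apply: ler_pM => //; rewrite mulr_ge0// ltW.
  lra.
- move=> /cvgryPge lim win; exists (1 / 3), 104; split; first by lra.
  have [C C0 bnd] := subcritical_bad_bound R.
  apply: (@whp_of_bexp R p _ (fun n E => subcritical_bad (p n) E)) => // e e0.
  (* Makes [C / B] at most [e]; both n^2 p and ln n eventually exceed this constant. *)
  pose B := Num.max 22 (C / e).
  have B22 : 22 <= B by rewrite le_max lexx.
  have BC : C / e <= B by rewrite le_max lexx orbT.
  near=> n.
  have n2 : (2 <= n)%N by near: n; exact: nbhs_infty_ge.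
  have pn := p01 n (ltnW n2); have /andP[p0 p1] := pn.
  have pp : 0 <= p n <= 1 by rewrite ltW.
  have Bn : B <= n%:R ^+ 2 * p n by near: n; exact: lim.
  have Bl : B <= ln n%:R by near: n; exact: near_ler_ln.
  have hyp : n%:R * p n <= 1 - (ln n%:R) `^ (1 / 2) * n%:R `^ (- (1 / 4)) by near: n.
  split; last first.
    apply: le_trans (bnd _ _ _ pn B22 Bn Bl hyp) _.
    by rewrite ler_pdivrMr; [rewrite mulrC -ler_pdivrMr|lra].
  have [w [t [[wB nw tw td _] _]]] := window_facts pn B22 Bl hyp.
  move=> G; rewrite !negb_or => /and3P[h1 h2 /exists_inPn h3].
  have t0 : 0 < t.
    have w0 : 0 < w by apply: lt_le_trans wB; lra.
    by rewrite -(pmulr_lgt0 _ (exprn_gt0 5 w0)) tw.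
  have d0 : 0 < 1 - n%:R * p n by lra.
  set d := 1 - n%:R * p n in d0 *; have dE : d = 1 - n%:R * p n by [].
  have pd3 : 8 * (56 * p n) <= d ^+ 3 by exact: window_density pn B22 Bl hyp.
  rewrite -!ltNge in h1 h2.
  apply: (subcritical_score (expected_edges_gt0 p0 n2 erefl) d0 h1 h2).
  - exact: (@mean_nb_linked_lower R n (p n) d pp d0 dE _ erefl pd3).
  - exact: (@moment1 R n (p n) d pp d0 dE _ erefl).
  - by move=> f fE; have := h3 f fE; rewrite -leNgt.
  - exact: (expected_edges_le p0 erefl).
  - exact: (expected_edges_ge p0 n2 erefl).
- move=> eps e01 win; have /andP[e0 e1] := e01.
  pose mu := expR (- (eps ^+ 3 / 2)); pose eta := eps ^+ 2 / 10.
  have e30 : 0 < eps ^+ 3 by rewrite exprn_gt0.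
  have mu01 : 0 < mu <= 1.
    by rewrite expR_gt0 expR_le1 oppr_le0 divr_ge0// ltW.
  (* [K] depends on [eps] alone: by exp x >= 1 + x it is enough that [K%:R * (eps ^+ 3 / 2)] reaches
     [8 / eps]. *)
  have [K muK] : exists K, mu ^+ K <= eps / 8.
    pose x := 16 / (eps * eps ^+ 3); exists (Num.bound x).
    have x0 : 0 <= x by rewrite divr_ge0 ?mulr_ge0// ltW.
    have := archi_boundP x0; set K := Num.bound x => /ltW xK.
    rewrite /mu -expRM_natl mulrN expRN -[leRHS]invrK lef_pV2 ?posrE ?expR_gt0 ?invr_gt0 ?divr_gt0//.
    apply: le_trans (expR_ge1Dx _).
    have : x * (eps ^+ 3 / 2) <= K%:R * (eps ^+ 3 / 2) by rewrite ler_wpM2r// divr_ge0// ltW.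
    have -> : x * (eps ^+ 3 / 2) = (eps / 8)^-1 by rewrite /x; field; rewrite gt_eqF.
    lra.
  have eta0 : 0 < eta by rewrite divr_gt0// exprn_gt0.
  apply: (@whp_of_bexp R p _ (fun n E => let a := #|pairs 'I_n|%:R * p n in
    (eta * a <= `|#|E|%:R - a|) ||
    (eta * a <= `|#|small_edges K E|%:R -
       bexp (p n) (pairs 'I_n) (fun E => #|small_edges K E|%:R)|))) => // e e'0.
  pose c : R := 1 + (2 * K + 1)%:R ^+ 2.
  have c0 : 0 <= c by rewrite addr_ge0// sqr_ge0.
  (* The thresholds ensure in turn [K%:R <= eps ^+ 3 * a], a total deviation probability at most
     [e], and the condition of [extinction_bound]. *)
  pose A1 := K%:R / eps ^+ 3; pose A2 := c / (eta ^+ 2 * e); pose A3 := 2 / eps ^+ 3.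
  near=> n.
  have n2 : (2 <= n)%N by near: n; exact: nbhs_infty_ge.
  have n0 : 0 < n%:R :> R by rewrite ltr0n ltnW.
  have pn := p01 n (ltnW n2); have /andP[p0 p1] := pn.
  have pp : 0 <= p n <= 1 by rewrite ltW.
  have /andP[np1 np2] : 1 <= n%:R * p n <= 1 + eps by near: n.
  have nA1 : 4 * A1 <= n%:R by near: n; exact: nbhs_infty_ger.
  have nA2 : 4 * A2 <= n%:R by near: n; exact: nbhs_infty_ger.
  have nA3 : A3 <= n%:R by near: n; exact: nbhs_infty_ger.
  set a := #|pairs 'I_n|%:R * p n.
  have a0 : 0 < a := expected_edges_gt0 p0 n2 erefl.
  (* Here np >= 1 is used: the expected number of edges is at least linear in [n]. *)
  have na : n%:R <= 4 * a.
    apply: le_trans (expected_edges_ge p0 n2 erefl).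
    by rewrite expr2 -mulrA ler_peMr// ltW.
  have aA1 : A1 <= a by lra.
  have aA2 : A2 <= a by lra.
  split; last first.
    apply: le_trans (bexp_union pp _ _ _) _.
    have t0 : 0 < eta * a by exact: mulr_gt0.
    have h1 := concentration_card n pp t0; have h2 := concentration_small n pp K t0.
    apply: le_trans (lerD h1 h2) _; rewrite -/a.
    have -> : a / (eta * a) ^+ 2 + a * (2 * K + 1)%:R ^+ 2 / (eta * a) ^+ 2 =
      c / (eta ^+ 2 * a) by rewrite /c; field; rewrite !gt_eqF.
    have ea0 : 0 < eta ^+ 2 * a by apply: mulr_gt0 => //; exact: exprn_gt0.
    have ee0 : 0 < eta ^+ 2 * e by apply: mulr_gt0 => //; exact: exprn_gt0.
    rewrite ler_pdivrMr//; move: aA2; rewrite /A2 ler_pdivrMr//.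
    lra.
  move=> G /=; rewrite -/a negb_or -!ltNge => /andP[h1 h2].
  rewrite modularity_ub ?components_partition//=.
  have rho01 : 0 <= 2 * eps + eps ^+ 2 < 1.
    have e2 : 0 <= eps ^+ 2 by exact: sqr_ge0.
    have : eps ^+ 2 <= eps * (1 / 4) by rewrite expr2 ler_wpM2l// ltW.
    by move=> ?; apply/andP; split; lra.
  have en : 2 <= eps ^+ 3 * n%:R by move: nA3; rewrite /A3 ler_pdivrMr// mulrC.
  have ext := extinction_bound e01 p0 n2 np2 en.
  have mean := large_edges_mean K pp rho01 mu01 ext.
  apply: (supercritical_score e01 a0 _ muK mean h1 h2).
  by move: aA1; rewrite /A1 ler_pdivrMr// mulrC.
Unshelve. all: by end_near. Qed.
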